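(* Let $A,B>0$ and let $1<p,q<\infty$ be such that $\frac1p+\frac1q=1$. There exists a constant $C>0$, depending only on $A,B,p$ and $q$, such that the following holds. Let $N\in\mathbb{N}$ with $N\ge 200\sqrt{B/A}$, let $d=N^2$ and let $l\ge1$. Then, for any $b\in\ell_2^{d,l}$ which generates an $A,B$-Gabor Riesz basis for $\ell_2^{d,l}$ and any $1\le k\le l$, $$C\log(N)\ \le\ \frac{1}{N^l}\sum_{\mathbf{j}\in I_d^l}\left|\frac{j_k}{N}\right|^p|b(\mathbf{j})|^2+\frac{1}{N^l}\sum_{\mathbf{j}\in I_d^l}\left|\frac{j_k}{N}\right|^q|\mathcal{F}_{d,l}b(\mathbf{j})|^2 .$$
   Context: Here $d=N^2$, $\mathbb{Z}_d=\mathbb{Z}/d\mathbb{Z}$, and $I_d=[-d/2,d/2)\cap\mathbb{Z}$ is the chosen set of representatives of $\mathbb{Z}_d$ (functions on $\mathbb{Z}_d^l$ are evaluated at points $\mathbf{j}=(j_1,\dots,j_l)\in I_d^l$). $\ell_2^{d,l}$ is the space of complex-valued functions on $\mathbb{Z}_d^l$ with norm $\|b\|_{\ell_2^{d,l}}^2=\frac{1}{N^l}\sum_{\mathbf{j}\in\mathbb{Z}_d^l}|b(\mathbf{j})|^2$. The discrete Fourier transform is $\mathcal{F}_{d,l}(b)(\mathbf{k})=\frac{1}{N^l}\sum_{\mathbf{j}\in\mathbb{Z}_d^l}b(\mathbf{j})e^{-2\pi i\,\mathbf{j}\cdot\mathbf{k}/d}$. The discrete Gabor system generated by $b$ is $G_{d,l}(b)=\{\,b(\mathbf{j}-N\mathbf{n})e^{2\pi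 i\,\mathbf{j}\cdot\mathbf{m}/N}\,\}_{(\mathbf{n},\mathbf{m})\in\{0,\dots,N-1\}^{2l}}$ (functions of $\mathbf{j}\in\mathbb{Z}_d^l$). We say $b$ generates an $A,B$-Gabor Riesz basis for $\ell_2^{d,l}$ if $G_{d,l}(b)=\{h_n\}$ is a basis of $\ell_2^{d,l}$ and $A\sum_n|c_n|^2\le\|\sum_n c_nh_n\|_{\ell_2^{d,l}}^2\le B\sum_n|c_n|^2$ for all scalars $(c_n)$. *)

(* Defs.v *)
From mathcomp Require Export all_boot all_order all_algebra.
From mathcomp Require Export complex.
From mathcomp Require Export reals exp trigo.
From mathcomp Require Import zify.

Set Implicit Arguments.
Unset Strict Implicit.
Unset Printing Implicit Defensive.
Import Order.TTheory GRing.Theory Num.Theory.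
Export ComplexField.Normc.

Local Open Scope ring_scope.
Local Open Scope complex_scope.

(* Z/dZ for d = N ^ 2.  The form 'I_(d.-1.+1) carries MathComp's additive group
   of integers mod d for every d >= 1; 'Z_d would denote Z/2Z when d = 1. *)
Notation Zd N := 'I_(N ^ 2)%N.-1.+1.

Notation Zdl N l := {ffun 'I_l -> Zd N}.

(* The representative of x in [-d/2, d/2) with d = N ^ 2; see repP. *)
Definition rep (N : nat) (x : Zd N) : int :=
  if (2 * val x < N ^ 2)%N then (val x)%:Z else (val x)%:Z - (N ^ 2)%:Z.

Lemma repP (N : nat) (x : Zd N) : (0 < N)%N ->
  [/\ - (N ^ 2)%:Z <= 2 * rep x, 2 * rep x < (N ^ 2)%:Z
    & (rep x = (val x)%:Z %[mod (N ^ 2)%:Z])%Z].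
Proof.
move=> N_gt0; have d_gt0 : (0 < N ^ 2)%N by rewrite expn_gt0 N_gt0.
have xd : (val x < N ^ 2)%N by rewrite -[ltnRHS](prednK d_gt0) ltn_ord.
rewrite /rep; case: ifP => hx; first by split=> //; lia.
split; [by lia | by lia |].
by apply/eqP; rewrite eqz_mod_dvd addrAC subrr add0r dvdzE abszN /=.
Qed.

(* All complex-valued functions on Z_d^l, as a finite-dimensional vector space
   over R[i] (the ^o makes the codomain a module over itself). *)
Notation l2 R N l := {ffun Zdl N l -> R[i]^o}.

Definition l2_normsq (R : realType) (N l : nat) (b : l2 R N l) : R :=
  (N%:R ^+ l)^-1 * \sum_(j : Zdl N l) normc (b j) ^+ 2.

(* exp (i t) *)
Definition expi (R : realType) (t : R) : R[i] := cos t +i* sin t.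

(* Computed on integer representatives, so only meaningful mod N ^ 2. *)
Definition dotZd (N l : nat) (j k : Zdl N l) : int :=
  \sum_(i < l) rep (j i) * rep (k i).

Definition dft (R : realType) (N l : nat) (b : l2 R N l) : l2 R N l :=
  [ffun k => ((N%:R ^+ l)^-1)%:C *
     \sum_(j : Zdl N l)
        b j * expi (- (2 * pi * (dotZd j k)%:~R / (N ^ 2)%:R))].

Notation gabor_idx N l := ({ffun 'I_l -> 'I_N} * {ffun 'I_l -> 'I_N})%type.

Definition gabor (R : realType) (N l : nat) (b : l2 R N l)
    (nm : gabor_idx N l) : l2 R N l :=
  let: (n, m) := nm in
  [ffun j : Zdl N l =>
     b (j - [ffun i => inZp (N * n i)]) *
     expi (2 * pi * (\sum_(i < l) rep (j i) * (val (m i))%:Z)%:~R / N%:R)].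

(* codom lists the system with repetitions, so basis_of also forces the members
   indexed by distinct (n, m) to be distinct. *)
Definition gabor_riesz_basis (R : realType) (N l : nat) (A B : R)
    (b : l2 R N l) : Prop :=
  basis_of fullv (codom (gabor b)) /\
  forall c : gabor_idx N l -> R[i],
    A * (\sum_nm normc (c nm) ^+ 2)
      <= l2_normsq (\sum_nm c nm *: gabor b nm)
      <= B * (\sum_nm normc (c nm) ^+ 2).

(* Main.v *)
(* Let G be the finite Zak transform of b.  The Riesz bounds say that
   A <= |G|^2 <= B pointwise, while G is a section of a line bundle with total
   curvature 2 pi over the discrete torus: translation in position and twisted
   translation in frequency commute up to a phase.  Such a section cannot vary
   slowly, so on any K x L subgrid it jumps somewhere by a fixed amount.

   Let P be the average of M ~ N / K translations.  Then
   G - (1 - P)^m G = P (sum_(i < m) (1 - P)^i G) is an average of a bounded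
   function, hence varies little over one grid step, so the jump has to be
   carried by the residual (1 - P)^m G, or by its frequency analogue.
   Averaging over all positions of the grid and using Parseval,
     A / 64 <= (K + 1) (L + 1) (||w_K^m dft b||^2 + ||w_L^m b||^2)
   with w_K(x) <= min 2 (C |x_k / N| / K).  Taking K ~ 2^(i/q), L ~ 2^(i/p), so
   that K L ~ 2^i, and m >= p, q, the sum over the ~ log N admissible i gives
   log N on the left, and on the right at most a multiple of the two moments,
   since sum_i 2^i min 1 (Y / 2^i)^2 <= 6 Y. *)
From HB Require Import structures.
From mathcomp Require Import topology derive normedtype.
From mathcomp Require Import ring lra zify.
Require Import Defs.
Import Order.TTheory GRing.Theory Num.Theory.
Import numFieldNormedType.Exports.
Local Open Scope ring_scope.
Local Open Scope complex_scope.

Set Implicit Arguments.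
Unset Strict Implicit.
Unset Printing Implicit Defensive.

(** * The unit circle and discrete curvature *)

Section ComplexNorm.
Variable R : realType.
Implicit Types (x y z : R[i]) (t : R).

Lemma normc_ge0 z : 0 <= normc z.
Proof. by case: z => a b; exact: sqrtr_ge0. Qed.

Lemma normcNE z : normc (- z) = normc z.
Proof. exact: (@normcN R z). Qed.

Lemma ler_normcD x y : normc (x + y) <= normc x + normc y.
Proof. exact: (@le_normcD R x y). Qed.

Lemma ler_normcB x y : normc (x - y) <= normc x + normc y.
Proof. by rewrite -(normcNE y) ler_normcD. Qed.

Lemma ler_normc_sum (I : Type) (r : seq I) (P : pred I) (F : I -> R[i]) :
  normc (\sum_(i <- r | P i) F i) <= \sum_(i <- r | P i) normc (F i).
Proof.
elim/big_ind2: _ => //; first by rewrite normc0.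
by move=> x a y b xa yb; rewrite (le_trans (ler_normcD _ _)) ?lerD.
Qed.

Lemma normc_real t : normc t%:C = `|t|.
Proof. by rewrite /= expr0n addr0 sqrtr_sqr. Qed.

Lemma normc_nat n : normc (n%:R : R[i]) = n%:R.
Proof. by rewrite -(rmorph_nat (real_complex R)) normc_real normr_nat. Qed.

Lemma normcX z n : normc (z ^+ n) = normc z ^+ n.
Proof. by elim: n => [|n IH]; rewrite ?normc1// !exprS normcM IH. Qed.

Lemma normc_neq0 z : (normc z != 0) = (z != 0).
Proof.
apply/idP/idP; apply: contra => /eqP.
  by move=> ->; rewrite normc0.
by move=> /eq0_normc ->.
Qed.

Lemma sqr_normcE z : (normc z ^+ 2)%:C = z * Num.conj z.
Proof.
case: z => a b /=; rewrite sqr_sqrtr ?addr_ge0 ?sqr_ge0//.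
by apply/eqP; rewrite eq_complex /= !expr2; apply/andP; split; apply/eqP; ring.
Qed.

Lemma expi0 : expi 0 = 1 :> R[i].
Proof. by rewrite /expi cos0 sin0. Qed.

Lemma expiD s t : expi (s + t) = expi s * expi t :> R[i].
Proof.
by rewrite /expi cosD sinD; apply/eqP; rewrite eq_complex /=; apply/andP; split;
  apply/eqP; ring.
Qed.

Lemma normc_expi t : normc (expi t) = 1.
Proof. by rewrite /= cos2Dsin2 sqrtr1. Qed.

Lemma expi_neq0 t : expi t != 0 :> R[i].
Proof. by rewrite -normc_neq0 normc_expi oner_neq0. Qed.

Lemma expiN t : expi (- t) = (expi t)^-1 :> R[i].
Proof.
by apply: (mulIf (expi_neq0 t)); rewrite -expiD addNr expi0 mulVf ?expi_neq0.
Qed.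

Lemma conj_expi t : Num.conj (expi t) = expi (- t) :> R[i].
Proof. by rewrite /expi cosN sinN. Qed.

Lemma expiMn t n : expi (t *+ n) = expi t ^+ n :> R[i].
Proof. by elim: n => [|n IH]; rewrite ?expi0// mulrS exprS expiD IH. Qed.

Lemma expi_2pi_int (n : int) : expi (2 * pi * n%:~R) = 1 :> R[i].
Proof.
have h : expi (2 * pi) = 1 :> R[i].
  by rewrite /expi mulr_natl cos2pi sin2pi.
case: n => n; first by rewrite -pmulrn mulr_natr expiMn h expr1n.
rewrite NegzE rmorphN /= mulrN expiN -pmulrn mulr_natr expiMn h expr1n.
by rewrite invr1.
Qed.

Lemma cosE_sin_half t : cos t = 1 - 2 * sin (t / 2) ^+ 2.
Proof. by rewrite {1}[t]splitr -mulr2n cos_mulr2n cos2sin2; ring. Qed.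

Lemma expi_eq1 t : expi t = 1 -> `|t| < 2 * pi -> t = 0.
Proof.
move=> [ct _] tpi; have /eqP : sin (t / 2) ^+ 2 = 0.
  by move: ct; rewrite cosE_sin_half; lra.
rewrite sqrf_eq0 => /eqP s0; have [t0|t0|//] := ltgtP t 0.
- have := @sin_gt0_pi R (- t / 2); rewrite mulNr sinN s0 oppr0 ltxx => h.
  by suff /h : 0 < - (t / 2) < pi by []; rewrite ltr0_norm // in tpi; lra.
- have := @sin_gt0_pi R (t / 2); rewrite s0 ltxx => h.
  by suff /h : 0 < t / 2 < pi by []; rewrite gtr0_norm // in tpi; lra.
Qed.

Lemma ler_norm_sin t : `|sin t| <= `|t|.
Proof.
wlog t0 : t / 0 <= t => [th|].
  have [/th//|/ltW t0] := leP 0 t.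
  by have := th (- t); rewrite sinN !normrN oppr_ge0; exact.
have [|c _] := @MVT_segment R sin cos 0 t t0.
  exact/continuous_subspaceT/continuous_sin.
rewrite sin0 !subr0 => ->; rewrite normrM -[leRHS]mul1r.
by rewrite ler_wpM2r ?normr_ge0 ?cos_max.
Qed.

Lemma normc_1Bexpi t : normc (1 - expi t) <= `|t|.
Proof.
rewrite -(@ler_pXn2r _ 2) ?nnegrE ?normc_ge0 //.
have -> : normc (1 - expi t) ^+ 2 = 4 * sin (t / 2) ^+ 2.
  rewrite /= sqr_sqrtr ?addr_ge0 ?sqr_ge0 // sub0r sqrrN (sin2cos2 t).
  by rewrite (cosE_sin_half t); ring.
have h : sin (t / 2) ^+ 2 <= (t / 2) ^+ 2.
  by rewrite -[leLHS]real_normK -1?[leRHS]real_normK ?num_real // lerXn2r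
    ?nnegrE ?normr_ge0 ?ler_norm_sin.
by rewrite real_normK ?num_real //; move: h; rewrite exprMn; lra.
Qed.

(** A branch of the argument, correct for Re z > 0, hence on the disc |z - 1| <= 1/2 where it is
    used. *)
Definition ang z : R := atan (complex.Im z / complex.Re z).

(** On this disc Re z >= 1/2 and |Im z| <= 1/2, so the slope lies in [-1, 1]. What matters is that
    four such angles add up to at most pi. *)
Lemma angP z : normc (z - 1) <= 1 / 2 ->
  [/\ `|ang z| <= pi / 4, z = (normc z)%:C * expi (ang z) & z != 0].
Proof.
case: z => x y; rewrite -(@ler_pXn2r _ 2) ?nnegrE ?normc_ge0 //; last by lra.
rewrite {1}/normc /= sqr_sqrtr ?addr_ge0 ?sqr_ge0 // subr0 => h.
have x12 : 1 / 2 <= x by nra.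
have y12 : `|y| <= 1 / 2.
  rewrite -(@ler_pXn2r _ 2) ?nnegrE ?normr_ge0 ?divr_ge0 //.
  by rewrite real_normK ?num_real //; have := sqr_ge0 (x - 1); lra.
have x0 : 0 < x by lra.
rewrite /ang /=; split.
- have /andP[h1 h2] : -1 <= y / x <= 1.
    by rewrite -ler_norml normrM normfV (gtr0_norm x0) ler_pdivrMr // mul1r; lra.
  rewrite ler_norml -atan1 -atanN; apply/andP; split.
    by apply: le_atan.
  by apply: le_atan.
- rewrite /expi; have c0 : cos (atan (y / x)) != 0.
    by apply/lt0r_neq0/cos_gt0_pihalf; rewrite atan_gtNpi2 atan_ltpi2.
  have -> : sin (atan (y / x)) = y / x * cos (atan (y / x)).
    by rewrite -[X in _ = X * _](atanK (y / x)) /tan divfK.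
  have e : Num.sqrt (x ^+ 2 + y ^+ 2) * cos (atan (y / x)) = x.
    rewrite cos_atan.
    have -> : x ^+ 2 + y ^+ 2 = x ^+ 2 * (1 + (y / x) ^+ 2).
      by field; rewrite gt_eqF.
    rewrite sqrtrM ?sqr_ge0 // sqrtr_sqr gtr0_norm // mulfK //.
    by rewrite gt_eqF // sqrtr_gt0 ltr_pwDl // sqr_ge0.
  apply/eqP; rewrite eq_complex /= !mul0r subr0 addr0 e eqxx /=.
  rewrite mulrCA e divfK // gt_eqF //.
- by apply/eqP => -[x0' _]; rewrite x0' ltxx in x0.
Qed.

(** Both sides have the same image under [expi] and differ by less than 4 (pi / 4) + pi = 2 pi, so
    they are equal. *)
Lemma ang_cocycle z1 z2 z3 z4 (k : R) :
  normc (z1 - 1) <= 1 / 2 -> normc (z2 - 1) <= 1 / 2 ->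
  normc (z3 - 1) <= 1 / 2 -> normc (z4 - 1) <= 1 / 2 ->
  `|k| < pi -> z1 * z2 = z3 * z4 * expi k ->
  ang z1 + ang z2 - ang z3 - ang z4 = k.
Proof.
move=> /angP[a1 e1 _] /angP[a2 e2 _] /angP[a3 e3 n3] /angP[a4 e4 n4] kpi e.
have en : normc z1 * normc z2 = normc z3 * normc z4.
  by rewrite -!normcM e (normcM _ (expi k)) normc_expi mulr1.
have n0 : (normc z3 * normc z4)%:C != 0.
  by rewrite fmorph_eq0 mulf_neq0 ?normc_neq0.
have ee : expi (ang z1 + ang z2) = expi (ang z3 + ang z4 + k) :> R[i].
  apply: (mulfI n0); rewrite -{1}en !expiD.
  rewrite !rmorphM /= mulrACA -e1 -e2 e mulrA [X in _ = X * _]mulrACA.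
  by rewrite -e3 -e4.
apply/eqP; rewrite -subr_eq0; apply/eqP; apply: expi_eq1.
  have -> : ang z1 + ang z2 - ang z3 - ang z4 - k =
    ang z1 + ang z2 + - (ang z3 + ang z4 + k) by ring.
  by rewrite expiD expiN ee divff ?expi_neq0.
move: a1 a2 a3 a4 kpi; rewrite !ler_norml !ltr_norml.
by move=> /andP[? ?] /andP[? ?] /andP[? ?] /andP[? ?] /andP[? ?]; lra.
Qed.

(* A nowhere vanishing section on a discrete torus whose parallel transports
   are all close to the identity has total curvature zero. *)
Lemma flat_curvature_sum0 (K L : nat) (g w : nat -> nat -> R[i])
    (k : nat -> nat -> R) :
  (forall i j, g i j != 0) -> (forall i j, w i j != 0) ->
  (forall i j, (i < K)%N -> (j < L)%N ->
     w i.+1 j = w i j * expi (k i j) /\ `|k i j| < pi) ->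
  (forall i, g i L = g i 0%N) ->
  (forall j, w K j * g K j.+1 / g K j = w 0%N j * g 0%N j.+1 / g 0%N j) ->
  (forall i j, (i < K)%N -> (j <= L)%N ->
     normc (g i.+1 j / g i j - 1) <= 1 / 2) ->
  (forall i j, (i <= K)%N -> (j < L)%N ->
     normc (w i j * g i j.+1 / g i j - 1) <= 1 / 2) ->
  \sum_(0 <= i < K) \sum_(0 <= j < L) k i j = 0.
Proof.
move=> g0 w0 hw gL gK hh hv.
(* [a] and [c] are the angles of the transports in the two directions; by [cell] the curvature of a
   cell is their circulation around it. *)
pose a i j := ang (g i.+1 j / g i j).
pose c i j := ang (w i j * g i j.+1 / g i j).
have cell i j : (i < K)%N -> (j < L)%N ->
    k i j = (c i.+1 j - c i j) - (a i j.+1 - a i j).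
  move=> iK jL; have [wE kpi] := hw i j iK jL.
  rewrite -(@ang_cocycle (g i.+1 j / g i j) (w i.+1 j * g i.+1 j.+1 / g i.+1 j)
    (g i.+1 j.+1 / g i j.+1) (w i j * g i j.+1 / g i j) (k i j)) ?hh ?hv // 1?ltnW //.
    by rewrite -/(a i j) -/(a i j.+1) -/(c i j) -/(c i.+1 j); ring.
  by rewrite wE; field; rewrite !g0.
transitivity (\sum_(0 <= i < K) \sum_(0 <= j < L)
    ((c i.+1 j - c i j) - (a i j.+1 - a i j))).
  apply: eq_big_nat => i /andP[_ iK]; apply: eq_big_nat => j /andP[_ jL].
  exact: cell.
(* The sums telescope: the [a] part closes up by [gL], the [c] part by [gK]. *)
under eq_bigr => i _ do rewrite sumrB telescope_sumr //.
rewrite sumrB [X in _ - X]big1 => [|i _]; last by rewrite /a !gL subrr.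
rewrite exchange_big /= big1 ?subr0 // => j _.
by rewrite telescope_sumr // /c gK subrr.
Qed.

End ComplexNorm.

(** * Averages over orbits *)

Section Averages.
Variables (C : fieldType).

Definition orbit_avg (W : lmodType C) (U : W -> W) (M : nat) (f : W) : W :=
  M%:R^-1 *: \sum_(s < M) iter s U f.

Definition orbit_res (W : lmodType C) (U : W -> W) (M : nat) (f : W) : W :=
  f - orbit_avg U M f.

(** Serves with [F] the Zak transform, and with [F] the value of [b] or of [dft b] at a point, where
    [U] becomes multiplication by a scalar. *)
Lemma orbit_res_intertwine (W W' : lmodType C) (F : {linear W -> W'})
    (U : W -> W) (U' : W' -> W') (M m : nat) (f : W) :
  (forall g, F (U g) = U' (F g)) ->
  F (iter m (orbit_res U M) f) = iter m (orbit_res U' M) (F f).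
Proof.
move=> FU; have Fiter s g : F (iter s U g) = iter s U' (F g).
  by elim: s => //= s IH; rewrite FU IH.
elim: m => //= m <-; rewrite /orbit_res /orbit_avg linearB linearZ /= linear_sum.
by congr (_ - _ *: _); apply: eq_bigr => s _; rewrite Fiter.
Qed.

Lemma orbit_res_scale (W : lmodType C) (c : C) (z : W) (M m : nat) :
  iter m (orbit_res ( *:%R c) M) z =
  (1 - M%:R^-1 * \sum_(s < M) c ^+ s) ^+ m *: z.
Proof.
have it s (y : W) : iter s ( *:%R c) y = c ^+ s *: y.
  by elim: s => [|s IH] /=; rewrite ?scale1r// IH exprS scalerA.
have res1 (y : W) :
    orbit_res ( *:%R c) M y = (1 - M%:R^-1 * \sum_(s < M) c ^+ s) *: y.
  rewrite /orbit_res /orbit_avg; under eq_bigr => s _ do rewrite it.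
  by rewrite -scaler_suml scalerA scalerBl scale1r.
by elim: m => [|m IH]; rewrite ?scale1r// iterS IH res1 scalerA exprS.
Qed.

(** Geometric sum: 1 - (1 - P)^m = P (1 + (1 - P) + ... + (1 - P)^(m-1)), with P the orbit
    average. *)
Lemma sub_iter_orbit_res (W : lmodType C) (U : {linear W -> W}) (M m : nat)
    (f : W) :
  f - iter m (orbit_res U M) f =
  orbit_avg U M (\sum_(i < m) iter i (orbit_res U M) f).
Proof.
have Uit s (g h : W) : iter s U (g + h) = iter s U g + iter s U h.
  by elim: s => //= s ->; rewrite linearD.
have avgD (g h : W) : orbit_avg U M (g + h) = orbit_avg U M g + orbit_avg U M h.
  rewrite /orbit_avg -scalerDr -big_split /=; congr (_ *: _).
  by apply: eq_bigr => s _.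
elim: m => [|m IH].
  rewrite big_ord0 subrr /orbit_avg big1 ?scaler0 // => s _.
  by elim: (nat_of_ord s) => //= k ->; rewrite linear0.
rewrite big_ord_recr avgD -IH /= {2}/orbit_res opprB addrA.
by rewrite addrAC.
Qed.

(** The sum over [0, M + t) can be split at t or at M. Hence the average of a bounded orbit moves by
    O(t / M) under t steps. *)
Lemma iter_orbit_avgB (W : lmodType C) (U : {linear W -> W}) (M t : nat) (f : W) :
  iter t U (orbit_avg U M f) - orbit_avg U M f =
  M%:R^-1 *: (\sum_(s < t) iter (M + s) U f - \sum_(s < t) iter s U f).
Proof.
have Uavg : iter t U (orbit_avg U M f) =
    M%:R^-1 *: \sum_(s < M) iter (t + s) U f.
  elim: t => //= t ->; rewrite linearZ linear_sum /=.
  by [].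
rewrite Uavg /orbit_avg -scalerBr; congr (_ *: _).
pose G s := iter s U f; have e m n : \sum_(s < m + n) G s =
    \sum_(s < m) G s + \sum_(s < n) G (m + s)%N by rewrite big_split_ord.
have := e t M; rewrite addnC e /G => h.
by apply/eqP; rewrite subr_eq addrAC eq_sym subr_eq addrC h addrC.
Qed.
End Averages.

(** * Translations twisted by a phase *)

Section WeightedComposition.
Variables (R : realType) (X : finType).
Implicit Types f g : {ffun X -> R[i]^o}.

(** One form for the plain translations, the modulations and the twisted translations of the Zak
    transform. *)
Definition wcomp (w : X -> R[i]) (h : X -> X) f : {ffun X -> R[i]^o} :=
  [ffun x => w x * f (h x)].

Lemma wcomp_is_linear w h : linear (wcomp w h).
Proof. by move=> a f g; apply/ffunP => x; rewrite !ffunE /= mulrDr mulrCA. Qed.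

HB.instance Definition _ w h := GRing.isLinear.Build _ _ _ _ (wcomp w h)
  (wcomp_is_linear w h).

Variables (w : X -> R[i]) (h : X -> X).
Hypothesis w1 : forall x, normc (w x) = 1.

Lemma normc_iter_wcomp s f x :
  normc (iter s (wcomp w h) f x) = normc (f (iter s h x)).
Proof.
elim: s x => // s IH x.
by rewrite iterS ffunE normcM w1 mul1r IH -iterSr.
Qed.

Lemma normc_orbit_avg_le M f c : (0 < M)%N -> (forall x, normc (f x) <= c) ->
  forall x, normc (orbit_avg (wcomp w h) M f x) <= c.
Proof.
move=> M0 fc x; rewrite /orbit_avg !ffunE normcM normcV normc_nat.
rewrite ler_pdivrMl ?ltr0n // sum_ffunE (le_trans (ler_normc_sum _ _ _)) //.
rewrite (le_trans (ler_sum _ (G := fun=> c) _)) // => [s _|].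
  by rewrite normc_iter_wcomp.
by rewrite sumr_const card_ord mulr_natl.
Qed.

Lemma normc_orbit_res_le M m f c : (0 < M)%N -> (forall x, normc (f x) <= c) ->
  forall x, normc (iter m (orbit_res (wcomp w h) M) f x) <= 2 ^+ m * c.
Proof.
move=> M0 fc; elim: m => [|m IH] x; first by rewrite mul1r.
rewrite iterS /orbit_res ffunE ffunE exprS -mulrA mulr_natl mulr2n.
by rewrite (le_trans (ler_normcB _ _)) // lerD // normc_orbit_avg_le.
Qed.

(* [f] minus the residual is an average over [M] translates, hence varies
   slowly under translation by [t << M]. *)
Lemma translate_le_orbit_res M m t f c x : (0 < M)%N ->
  (forall x, normc (f x) <= c) ->
  let r := iter m (orbit_res (wcomp w h) M) f in
  normc (iter t (wcomp w h) f x - f x) <=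
    normc (r (iter t h x)) + normc (r x) + 2 ^+ m.+1 * (t%:R / M%:R) * c.
Proof.
move=> M0 fc; set r := iter m _ f; cbv zeta.
(* Here f = r + P H, and 1 - P at most doubles a uniform bound, so |H| <= (1 + 2 + ... + 2^(m-1)) c
   <= 2^m c. *)
pose H := \sum_(i < m) iter i (orbit_res (wcomp w h) M) f.
have fE : f = r + orbit_avg (wcomp w h) M H by rewrite -sub_iter_orbit_res addrC subrK.
have Hc y : normc (H y) <= 2 ^+ m * c.
  rewrite /H sum_ffunE (le_trans (ler_normc_sum _ _ _)) //.
  have c0 : 0 <= c by rewrite (le_trans (normc_ge0 _) (fc y)).
  apply: (@le_trans _ _ (\sum_(i < m) 2 ^+ i * c)).
    by apply: ler_sum => i _; exact: normc_orbit_res_le.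
  rewrite -mulr_suml ler_wpM2r //.
  elim: (m) => [|k IH]; first by rewrite big_ord0.
  by rewrite big_ord_recr exprS mulr_natl mulr2n lerD2r.
have -> : iter t (wcomp w h) f x - f x =
    iter t (wcomp w h) r x - r x + (iter t (wcomp w h) (orbit_avg (wcomp w h) M H)
      - orbit_avg (wcomp w h) M H) x.
  have it g g' : iter t (wcomp w h) (g + g') =
      iter t (wcomp w h) g + iter t (wcomp w h) g'.
    by elim: (t) => //= s ->; rewrite linearD.
  by rewrite {1 2}fE it !ffunE; ring.
rewrite (le_trans (ler_normcD _ _)) // lerD //.
  by rewrite (le_trans (ler_normcB _ _)) // normc_iter_wcomp.
rewrite iter_orbit_avgB ffunE normcM normcV normc_nat.
have -> : 2 ^+ m.+1 * (t%:R / M%:R) * c = M%:R^-1 * (t%:R * (2 ^+ m * c) *+ 2) :> R.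
  by rewrite exprS; ring.
rewrite ler_wpM2l ?invr_ge0 // mulr2n !ffunE !sum_ffunE.
(* Two sums of [t] terms, each at most t 2^m c, account for the factor 2^(m+1). *)
have le_t (p : nat -> nat) :
    normc (\sum_(s < t) iter (p s) (wcomp w h) H x) <= t%:R * (2 ^+ m * c).
  rewrite (le_trans (ler_normc_sum _ _ _)) //.
  rewrite (le_trans (ler_sum _ (G := fun=> 2 ^+ m * c) _)) // => [s _|].
    by rewrite normc_iter_wcomp.
  by rewrite sumr_const card_ord mulr_natl.
apply: le_trans (ler_normcB _ _) _; apply: lerD; last exact: (le_t id).
exact: (le_t (addn M)).
Qed.

End WeightedComposition.

(** * Characters of the phase space *)

Section Characters.
Variables (R : realType) (N l : nat).
Hypothesis N_gt1 : (1 < N)%N.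
Local Notation V := (Zdl N l).
Local Notation d := (N ^ 2)%N.

Definition chi (x y : V) : R[i] := expi (2 * pi * (dotZd x y)%:~R / d%:R).

Let d_gt0 : (0 < d)%N. Proof. by rewrite expn_gt0 ltnW. Qed.
Let d_neq0 : d%:R != 0 :> R. Proof. by rewrite pnatr_eq0 -lt0n. Qed.

Lemma expi_eqz_mod (a b : int) : (a = b %[mod d%:Z])%Z ->
  expi (2 * pi * a%:~R / d%:R) = expi (2 * pi * b%:~R / d%:R) :> R[i].
Proof.
move=> /eqP; rewrite eqz_mod_dvd => /dvdzP[c /eqP]; rewrite subr_eq => /eqP ->.
rewrite intrD intrM mulrDr mulrDl expiD.
have -> : 2 * pi * (c%:~R * (d%:Z)%:~R) / d%:R = 2 * pi * c%:~R :> R.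
  by rewrite -!mulrA (mulfV d_neq0) mulr1.
by rewrite expi_2pi_int mul1r.
Qed.

(** [rep] is additive only modulo d; as [expi] sees the exponent modulo d, any integer lifts of the
    coordinates may replace it. *)
Lemma chi_eqz_mod (x y : V) (u v : 'I_l -> int) :
  (forall i, rep (x i) = u i %[mod d%:Z])%Z ->
  (forall i, rep (y i) = v i %[mod d%:Z])%Z ->
  chi x y = expi (2 * pi * (\sum_i u i * v i)%:~R / d%:R).
Proof.
move=> xu yv; apply: expi_eqz_mod; apply/eqP; rewrite eqz_mod_dvd /dotZd -sumrB.
apply: rpred_sum => i _.
have -> : rep (x i) * rep (y i) - u i * v i =
  (rep (x i) - u i) * rep (y i) + u i * (rep (y i) - v i) by ring.
apply: rpredD; [apply: dvdz_mulr|apply: dvdz_mull]; rewrite -eqz_mod_dvd; exact/eqP.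
Qed.

Lemma rep_val (x : Zd N) : (rep x = (val x)%:Z %[mod d%:Z])%Z.
Proof. by have [] := repP x (ltnW N_gt1). Qed.

Lemma val_ZdD (x y : Zd N) : val (x + y) = ((val x + val y) %% d)%N.
Proof. by congr (_ %% _)%N; exact: prednK. Qed.

Lemma val_inZd n : val (inZp n : Zd N) = (n %% d)%N.
Proof. by congr (_ %% _)%N; exact: prednK. Qed.

Lemma rep_add_mod (x y : Zd N) : (rep (x + y) = rep x + rep y %[mod d%:Z])%Z.
Proof.
rewrite rep_val val_ZdD -modz_nat modz_mod PoszD.
by apply/eqP; rewrite -modzDm -!rep_val modzDm.
Qed.

Lemma chiC x y : chi x y = chi y x.
Proof. by rewrite /chi /dotZd; under eq_bigr do rewrite mulrC. Qed.

Lemma chiDl x y z : chi (x + y) z = chi x z * chi y z.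
Proof.
rewrite (@chi_eqz_mod _ _ (fun i => rep (x i) + rep (y i)) (fun i => rep (z i))) //.
  rewrite /chi -expiD -mulrDl -mulrDr -intrD -big_split /=.
  by under eq_bigr do rewrite mulrDl.
by move=> i; rewrite ffunE rep_add_mod.
Qed.

Lemma chiDr x y z : chi x (y + z) = chi x y * chi x z.
Proof. by rewrite chiC chiDl !(chiC x). Qed.

Lemma normc_chi x y : normc (chi x y) = 1.
Proof. exact: normc_expi. Qed.

Lemma chi_neq0 x y : chi x y != 0.
Proof. exact: expi_neq0. Qed.

Lemma chi0l x : chi 0 x = 1.
Proof. by apply: (mulfI (chi_neq0 0 x)); rewrite -chiDl addr0 mulr1. Qed.

Lemma chi0r x : chi x 0 = 1.
Proof. by rewrite chiC chi0l. Qed.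

Lemma chiNl x y : chi (- x) y = (chi x y)^-1.
Proof.
by apply: (mulIf (chi_neq0 x y)); rewrite -chiDl addNr chi0l mulVf ?chi_neq0.
Qed.

Lemma chiMnl x y n : chi (x *+ n) y = chi x y ^+ n.
Proof. by elim: n => [|n IH]; rewrite ?chi0l// mulrS exprS chiDl IH. Qed.

Lemma conj_chi x y : Num.conj (chi x y) = chi (- x) y.
Proof. by rewrite chiNl /chi conj_expi expiN. Qed.

Definition unitv (k : 'I_l) : V := [ffun i => inZp (i == k)].

Lemma chi_unitv k x : chi (unitv k) x = expi (2 * pi * (rep (x k))%:~R / d%:R).
Proof.
rewrite (@chi_eqz_mod _ _ (fun i => (i == k)%:Z) (fun i => rep (x i))) //.
  rewrite (bigD1 k) //= eqxx mul1r big1 ?addr0 // => i /negPf ->.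
  by rewrite mul0r.
move=> i; rewrite ffunE rep_val /= prednK // -modz_nat modz_mod //.
Qed.

Lemma rep_unitv k : rep (unitv k k) = 1.
Proof.
rewrite /rep ffunE eqxx /= prednK // modn_small; last by nia.
by case: ifP => //; nia.
Qed.

(** The commutation phase of [s] translations and [t] modulations, that is, the curvature of an s by
    t cell. *)
Lemma chi_unitv_mul k s t :
  chi (unitv k *+ s) (unitv k *+ t) = expi (2 * pi * (s%:R * t%:R) / d%:R).
Proof.
rewrite chiMnl chiC chiMnl -exprM chi_unitv rep_unitv -expiMn; congr expi.
by rewrite -mulr_natr natrM; ring.
Qed.

(** Shifting the summation variable by [y] multiplies the sum by [chi y k]. *)
Lemma sum_chi_stable (G : {set V}) (y k : V) :
  (forall x, (x + y \in G) = (x \in G)) -> chi y k != 1 ->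
  \sum_(x in G) chi x k = 0.
Proof.
move=> Gy y1; apply/eqP; rewrite -(mulrI_eq0 _ (lregP _ : GRing.lreg (chi y k - 1))).
  rewrite mulrBl mul1r subr_eq0 mulr_sumr; apply/eqP.
  rewrite [RHS](reindex_inj (addIr y)) /=.
  by apply: eq_big => [x|x _]; rewrite ?Gy// chiDl mulrC.
by rewrite subr_eq0.
Qed.

Lemma ltn_Zd (x : Zd N) : (val x < d)%N.
Proof. by rewrite -[ltnRHS](prednK d_gt0) ltn_ord. Qed.

Lemma rep_eq0 (x : Zd N) : rep x = 0 -> x = 0.
Proof.
move=> x0; apply/val_inj => /=; move: (ltn_Zd x) x0.
by rewrite /rep /=; case: ifP => _; lia.
Qed.

Lemma expi_rep_neq1 (a : int) : a != 0 -> `|a| < d%:Z ->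
  expi (2 * pi * a%:~R / d%:R) != 1 :> R[i].
Proof.
move=> a0 ad; apply/eqP => /expi_eq1 h; have d0 : 0 < d%:R :> R by rewrite ltr0n.
have pi0 := pi_gt0 R.
suff /eqP : 2 * pi * a%:~R / d%:R = 0 :> R.
  by rewrite !mulf_eq0 invr_eq0 (negPf d_neq0) intr_eq0 (negPf a0) (gt_eqF pi0) pnatr_eq0.
apply: h; rewrite normrM normfV (gtr0_norm d0) ltr_pdivrMr // normrM.
rewrite gtr0_norm ?mulr_gt0 // ltr_pM2l ?mulr_gt0 //.
by rewrite -intr_norm -[ltRHS]/((d%:Z)%:~R) ltr_int.
Qed.

Lemma sum_chi (k : V) : \sum_x chi x k = (k == 0)%:R * (d ^ l)%:R.
Proof.
have [->|k0] := eqVneq k 0.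
  under eq_bigr do rewrite chi0r.
  by rewrite sumr_const card_ffun !card_ord prednK // mul1r.
have [i ki] : exists i, k i != 0.
  apply/existsP; apply: contraNT k0 => /existsPn h.
  by apply/eqP/ffunP => i; rewrite ffunE; apply/eqP; rewrite -[_ == _]negbK.
rewrite mul0r; transitivity (\sum_(x in [set: V]) chi x k).
  by apply: eq_bigl => x; rewrite inE.
apply: (@sum_chi_stable _ (unitv i)); first by move=> x; rewrite !inE.
rewrite chi_unitv expi_rep_neq1 //; first by apply: contra ki => /eqP/rep_eq0 ->.
by have [] := repP (k i) (ltnW N_gt1); lia.
Qed.

Lemma parseval (a : V -> R[i]) :
  \sum_v normc (\sum_x a x * chi x v) ^+ 2 =
  (d ^ l)%:R * \sum_x normc (a x) ^+ 2.
Proof.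
apply: (@fmorph_inj _ _ (real_complex R)).
rewrite rmorphM !rmorph_sum /= rmorph_nat.
under eq_bigr do rewrite sqr_normcE rmorph_sum /= mulr_suml.
rewrite exchange_big /= mulr_sumr; apply: eq_bigr => x _.
rewrite sqr_normcE.
under eq_bigr do rewrite mulr_sumr.
rewrite exchange_big /= (bigD1 x) //= [X in _ + X]big1 ?addr0 => [|y yx].
  under eq_bigr => v _ do rewrite rmorphM /= conj_chi chiNl.
  under eq_bigr => v _ do rewrite mulrACA divff ?chi_neq0 // mulr1.
  by rewrite sumr_const card_ffun !card_ord prednK // mulr_natl.
under eq_bigr => v _ do rewrite rmorphM /= conj_chi mulrACA -chiDl chiC.
by rewrite -mulr_sumr sum_chi subr_eq0 eq_sym (negPf yx) mul0r mulr0.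
Qed.

(** The subgroup N Z_d^l. As d = N^2, it is its own annihilator under [chi]; see [chi_Lam] and
    [sum_Lam_chi]. *)
Definition Lam : {set V} := [set x : V | [forall i, (N %| val (x i))%N]].

Lemma LamP (x : V) : reflect (forall i, (N %| val (x i))%N) (x \in Lam).
Proof. by rewrite inE; exact: forallP. Qed.

Let N_dvd_d : (N %| d)%N. Proof. by rewrite dvdn_exp. Qed.

Lemma LamDr (x y : V) : y \in Lam -> (x + y \in Lam) = (x \in Lam).
Proof.
move=> /LamP yL; rewrite !inE; apply: eq_forallb => i.
by rewrite ffunE val_ZdD /dvdn modn_dvdm // -/(dvdn _ _) dvdn_addl ?yL.
Qed.

Lemma Lam0 : (0 : V) \in Lam.
Proof. by apply/LamP => i; rewrite ffunE /=. Qed.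

Lemma LamN (x : V) : (- x \in Lam) = (x \in Lam).
Proof.
have h y : y \in Lam -> - y \in Lam.
  by move=> yL; rewrite -(LamDr _ yL) addNr Lam0.
by apply/idP/idP => /h; rewrite ?opprK.
Qed.

Lemma chi_Lam (x y : V) : x \in Lam -> y \in Lam -> chi x y = 1.
Proof.
move=> /LamP xL /LamP yL.
rewrite (@chi_eqz_mod _ _ (fun i => (val (x i))%:Z) (fun i => (val (y i))%:Z));
  try by move=> i; rewrite rep_val.
rewrite (@expi_eqz_mod _ 0); first by rewrite mulr0 mul0r expi0.
apply/eqP; rewrite eqz_mod_dvd subr0.
apply: rpred_sum => i _.
by rewrite -PoszM dvdzE; exact: (dvdn_mul (xL i) (yL i)).
Qed.

Lemma unitv_Lam k n : (N %| n)%N -> unitv k *+ n \in Lam.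
Proof.
move=> /dvdnP[c ->]; apply/LamP => i; rewrite ffunMnE Zp_mulrn val_inZd.
by rewrite /dvdn modn_dvdm // -/(dvdn _ _) mulnA dvdn_mull.
Qed.

(** The same term as the shift in [gabor], so that sums over Gabor indices become sums over
    [Lam]. *)
Definition lattice_pt (n : {ffun 'I_l -> 'I_N}) : V := [ffun i => inZp (N * n i)].

Let val_lattice_pt n i : val (lattice_pt n i) = (N * n i)%N.
Proof.
rewrite ffunE val_inZd modn_small // -mulnn ltn_mul2l ltn_ord andbT.
exact: ltnW.
Qed.

Lemma lattice_pt_inj : injective lattice_pt.
Proof.
move=> n m nm; apply/ffunP => i; apply/val_inj/eqP.
have := val_lattice_pt n i; rewrite nm val_lattice_pt => /eqP.
by rewrite eqn_pmul2l ?(ltnW N_gt1) // eq_sym.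
Qed.

Lemma lattice_pt_imset : lattice_pt @: setT = Lam.
Proof.
apply/setP => x; apply/imsetP/LamP => [[n _ ->] i|xL].
  by rewrite val_lattice_pt dvdn_mulr.
have h i : (val (x i) %/ N < N)%N.
  rewrite ltn_divLR ?(ltnW N_gt1) //.
  exact: (ltn_Zd (x i)).
exists [ffun i => Ordinal (h i)]; first by rewrite inE.
apply/ffunP => i; apply/val_inj; rewrite val_lattice_pt ffunE /= mulnC.
by apply: esym; apply: divnK; exact: xL.
Qed.

Lemma sum_lattice_pt (W : nmodType) (F : V -> W) :
  \sum_n F (lattice_pt n) = \sum_(x in Lam) F x.
Proof.
rewrite -lattice_pt_imset big_imset /=; last by move=> ? ? _ _; exact: lattice_pt_inj.
by apply: eq_bigl => n; rewrite inE.
Qed.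

Lemma card_Lam : #|Lam| = (N ^ l)%N.
Proof.
rewrite -lattice_pt_imset card_imset ?cardsT ?card_ffun ?card_ord //.
exact: lattice_pt_inj.
Qed.

Lemma sum_Lam_chi (x : V) :
  \sum_(y in Lam) chi y x = (x \in Lam)%:R * (N ^ l)%:R.
Proof.
have [xL|xL] := boolP (x \in Lam).
  rewrite (eq_bigr (fun=> 1)) => [|y yL]; last exact: chi_Lam.
  by rewrite sumr_const card_Lam mul1r.
have [i xi] : exists i, ~~ (N %| val (x i))%N.
  by apply/existsP; rewrite -negb_forall; move: xL; rewrite inE.
rewrite mul0r (@sum_chi_stable _ (unitv i *+ N)) // => [y|].
  by rewrite LamDr // unitv_Lam.
rewrite chiMnl chi_unitv -expiMn.
have -> : (2 * pi * (rep (x i))%:~R / d%:R) *+ N =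
    2 * pi * (rep (x i) * N%:Z)%:~R / d%:R :> R.
  by rewrite intrM -mulr_natr; ring.
(* Modulo d the exponent is N (x_i mod N), which is non-zero and less than d because N does not
   divide x_i. *)
rewrite (@expi_eqz_mod _ ((val (x i) %% N) * N)%N%:Z).
  rewrite expi_rep_neq1 //.
    by rewrite -lt0n muln_gt0 lt0n xi ltnW.
  by rewrite ger0_norm // ltz_nat -[ltnRHS]/(N * N)%N ltn_pmul2r ?ltn_mod ltnW.
have /eqP := rep_val (x i); rewrite eqz_mod_dvd => /dvdzP[c hc].
apply/eqP; rewrite eqz_mod_dvd; apply/dvdzP.
exists (c * N%:Z + (val (x i) %/ N)%N%:Z).
move: hc (divn_eq (val (x i)) N); move: (val (x i)) (rep (x i)) => v w.
by rewrite -mulnn => /eqP; rewrite subr_eq => /eqP -> {1}->; rewrite !PoszD !PoszM; ring.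
Qed.

End Characters.

(** * The Zak transform *)

Section Zak.
Variables (R : realType) (N l : nat).
Hypothesis N_gt1 : (1 < N)%N.
Local Notation V := (Zdl N l).
Local Notation d := (N ^ 2)%N.
Local Notation chi := (@chi R N l).
Local Notation Lam := (@Lam N l).
Local Notation lattice_pt := (@lattice_pt N l).
Implicit Types (b : l2 R N l) (j v x y : V).

Let N_gt0 : (0 < N)%N. Proof. exact: ltnW. Qed.
Let N_neq0 : N%:R != 0 :> R. Proof. by rewrite pnatr_eq0 -lt0n. Qed.

Let oppV_inj : injective (fun x : V => - x).
Proof. exact: oppr_inj. Qed.

(** The finite Zak transform, kept on all of V x V; [zakDl] and [zakDr] give its quasi-periodicity
    along [Lam]. *)
Definition zak b : {ffun V * V -> R[i]^o} :=
  [ffun p : V * V => \sum_(x in Lam) b (p.1 + x) * chi x p.2].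

Lemma zak_is_linear : linear zak.
Proof.
move=> a b b'; apply/ffunP => p; rewrite !ffunE /GRing.scale /= mulr_sumr.
by rewrite -big_split; apply: eq_bigr => x _; rewrite !ffunE /= mulrDl mulrA.
Qed.

HB.instance Definition _ := GRing.isLinear.Build _ _ _ _ zak zak_is_linear.

Lemma zak_translate y b :
  zak (wcomp (fun=> 1) (fun j : V => j + y) b) =
  wcomp (fun=> 1) (fun p : V * V => (p.1 + y, p.2)) (zak b).
Proof.
apply/ffunP => p; rewrite !ffunE mul1r; apply: eq_bigr => x _ /=.
by rewrite ffunE mul1r addrAC.
Qed.

(** Since chi(j + x, y) chi(x, v) = chi(j, y) chi(x, v + y), translation in frequency carries a
    phase that depends on position: this is the source of the curvature. *)
Lemma zak_modulate y b :
  zak (wcomp (fun j : V => chi j y) id b) =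
  wcomp (fun p : V * V => chi p.1 y) (fun p : V * V => (p.1, p.2 + y)) (zak b).
Proof.
apply/ffunP => p; rewrite !ffunE mulr_sumr; apply: eq_bigr => x _ /=.
by rewrite ffunE chiDl // chiDr //; ring.
Qed.

Lemma zakDl b j v y : y \in Lam -> zak b (j + y, v) = chi (- y) v * zak b (j, v).
Proof.
move=> yL; rewrite !ffunE /= mulr_sumr (reindex_inj (addrI (- y))) /=.
apply: eq_big => [x|x _]; first by rewrite addrC LamDr ?LamN.
by rewrite addrA addrK chiDl //; ring.
Qed.

Lemma zakDr b j v y : y \in Lam -> zak b (j, v + y) = zak b (j, v).
Proof.
move=> yL; rewrite !ffunE /=; apply: eq_bigr => x xL.
by rewrite chiDr // (chi_Lam _ _ xL yL) // mulr1.
Qed.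

(** [parseval] in [v] gives d^l; each value of [b] is then met once for each of the N^l elements of
    [Lam]. *)
Lemma zak_parseval b :
  \sum_p normc (zak b p) ^+ 2 =
  (d ^ l)%:R * (N ^ l)%:R * \sum_j normc (b j) ^+ 2.
Proof.
transitivity (\sum_j \sum_v normc (zak b (j, v)) ^+ 2).
  by rewrite pair_big; apply: eq_bigr => -[].
pose a j x := if x \in Lam then b (j + x) else 0.
have zakE j v : zak b (j, v) = \sum_x a j x * chi x v.
  rewrite ffunE big_mkcond; apply: eq_bigr => x _ /=.
  by rewrite /a; case: ifP; rewrite ?mul0r.
under eq_bigr => j _ do under eq_bigr => v _ do rewrite zakE.
under eq_bigr => j _ do rewrite parseval //.
rewrite -mulr_sumr -mulrA; congr (_ * _); rewrite exchange_big /=.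
rewrite (bigID (mem Lam)) /= [X in _ + X]big1 ?addr0 => [|x /negPf xL]; last first.
  by apply: big1 => j _; rewrite /a xL normc0 expr0n.
rewrite -(card_Lam l N_gt1) mulr_natl -sumr_const; apply: eq_bigr => x xL.
rewrite [RHS](reindex_inj (addIr x)) /=.
by apply: eq_bigr => j _; rewrite /a xL.
Qed.

Lemma dftE b x :
  dft b x = ((N%:R ^+ l)^-1)%:C * \sum_j b j * chi (- j) x.
Proof.
by rewrite ffunE; congr (_ * _); apply: eq_bigr => j _; rewrite chiNl // /chi expiN.
Qed.

Lemma dft_translate y b x :
  dft (wcomp (fun=> 1) (fun j : V => j + y) b) x = chi y x * dft b x.
Proof.
rewrite !dftE mulrCA; congr (_ * _).
rewrite [in RHS](reindex_inj (addIr y)) mulr_sumr /=; apply: eq_bigr => j _.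
rewrite ffunE mul1r opprD chiDl // (chiNl _ N_gt1 y) //.
by rewrite mulrCA [chi (- j) x * _]mulrC [chi y x * _]mulrA divff ?chi_neq0 ?mul1r.
Qed.

Lemma dft_parseval b : \sum_x normc (dft b x) ^+ 2 = \sum_j normc (b j) ^+ 2.
Proof.
have NlE : normc ((N%:R ^+ l)^-1)%:C = (N%:R ^+ l)^-1 :> R.
  by rewrite normc_real normfV normrX normr_nat.
have swap x : \sum_(j : V) b j * chi (- j) x = \sum_(j : V) b (- j) * chi j x.
  by rewrite (reindex_inj oppV_inj) /=; apply: eq_bigr => j _; rewrite opprK.
under eq_bigr => x _ do rewrite dftE normcM NlE exprMn swap.
rewrite -mulr_sumr /=.
rewrite (parseval N_gt1 (fun j : V => b (- j))) mulrA natrX exprVn natrX -!exprM mulnC.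
rewrite mulVf ?expf_neq0 // mul1r [RHS](reindex_inj oppV_inj) //.
Qed.

(** Modulation by m / N is the character of N m, because d = N^2. *)
Lemma gaborE b n m j :
  gabor b (n, m) j = b (j - lattice_pt n) * chi j (lattice_pt m).
Proof.
rewrite ffunE; congr (_ * _).
rewrite (@chi_eqz_mod R N l N_gt1 _ _ (fun i => rep (j i)) (fun i => (N * m i)%N%:Z)) //;
  last by move=> i; rewrite ffunE rep_val // val_inZd // -modz_nat modz_mod.
have -> : \sum_i rep (j i) * (N * m i)%N%:Z =
    (\sum_i rep (j i) * (val (m i))%:Z) * N%:Z :> int.
  by rewrite mulr_suml; apply: eq_bigr => i _; rewrite PoszM mulrA mulrAC.
by congr expi; rewrite intrM natrX; field.
Qed.

(** The Riesz inequality is tested on the coefficients chi(-N n, v) chi(-j0, N m). The sum over m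
    confines the combination to j0 + Lam and the sum over n produces the Zak transform, so its
    modulus on that coset is N^l |zak b (j0, v)|. *)
Lemma zak_bounds A B b p : gabor_riesz_basis A B b ->
  A <= normc (zak b p) ^+ 2 <= B.
Proof.
case: p => j0 v [_ /(_ (fun nm => chi (- lattice_pt nm.1) v * chi (- j0) (lattice_pt nm.2)))].
set f := \sum_nm _ *: _; pose D : R := N%:R ^+ l.
have D0 : 0 < D by rewrite exprn_gt0 // ltr0n.
have fE j : f j = zak b (j, v) * ((j - j0 \in Lam)%:R * (N ^ l)%:R).
  rewrite sum_ffunE /= -(sum_Lam_chi R N_gt1) -(sum_lattice_pt N_gt1).
  rewrite ffunE /= (reindex_inj oppV_inj) /=.
  under [X in _ = X * _]eq_bigl => x do rewrite LamN //.
  rewrite -(sum_lattice_pt N_gt1 (fun x => b (j - x) * chi (- x) v)) mulr_suml.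
  under [RHS]eq_bigr => n _ do rewrite mulr_sumr.
  rewrite pair_big /=; apply: eq_bigr => -[n m] _ /=.
  rewrite ffunE gaborE /GRing.scale /= (chiC _ (lattice_pt m)) chiDl //.
  by ring.
have -> : \sum_nm normc (chi (- lattice_pt nm.1) v * chi (- j0) (lattice_pt nm.2)) ^+ 2
    = D ^+ 2 :> R.
  under eq_bigr => nm _ do rewrite normcM !normc_chi mulr1 expr1n.
  by rewrite sumr_const card_prod !card_ffun !card_ord natrM natrX.
have -> : l2_normsq f = D ^+ 2 * normc (zak b (j0, v)) ^+ 2.
  rewrite /l2_normsq -/D (reindex_inj (addIr j0)) /= (bigID (mem Lam)) /=.
  rewrite [X in _ + X]big1 ?addr0 => [|j jL]; last first.
    by rewrite fE addrK (negPf jL) mul0r mulr0 normc0 expr0n.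
  rewrite (eq_bigr (fun=> D ^+ 2 * normc (zak b (j0, v)) ^+ 2)) => [|j jL].
    rewrite sumr_const card_Lam // -mulr_natl natrX -/D -mulrA mulKf //.
    by rewrite gt_eqF.
  rewrite fE addrK jL mul1r addrC zakDl // !normcM normc_chi normc_nat natrX -/D.
  by rewrite mul1r exprMn mulrC.
have D2 : 0 < D ^+ 2 by rewrite exprn_gt0.
by rewrite [A * _]mulrC [B * _]mulrC !(ler_pM2l D2).
Qed.

End Zak.

(** * One scale *)

Section Grid.
Variables (N K : nat).
Hypotheses (K_gt0 : (0 < K)%N) (KN : (K <= N)%N).

(** Rounded equispaced points: K need not divide N, yet the K steps add up to exactly N. *)
Definition node (i : nat) : nat := (i * N %/ K)%N.

Lemma node0 : node 0 = 0%N.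
Proof. by rewrite /node mul0n div0n. Qed.

Lemma node_last : node K = N.
Proof. by rewrite /node mulKn. Qed.

Lemma node_le i : (node i <= node i.+1)%N.
Proof. by rewrite leq_div2r // leq_mul2r leqnSn orbT. Qed.

Definition step (i : nat) : nat := (node i.+1 - node i)%N.

Lemma node_step i : node i.+1 = (node i + step i)%N.
Proof. by rewrite subnKC ?node_le. Qed.

Lemma step_le i : (step i <= (N %/ K).+1)%N.
Proof.
rewrite /step leq_subLR /node mulSn.
have := divnD N (i * N) K_gt0; lia.
Qed.

Lemma step_mul_le i : (step i * K <= 2 * N)%N.
Proof.
rewrite (leq_trans (leq_mul (step_le i) (leqnn K))) //.
by rewrite mulSn; have := leq_divM N K; lia.
Qed.

End Grid.

(** * Point values as linear functionals *)

Section Evaluation.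
Variables (R : realType) (N l : nat) (x : Zdl N l).

Definition eval_at (b : l2 R N l) : R[i]^o := b x.

Lemma eval_at_is_linear : linear eval_at.
Proof. by move=> a f g; rewrite /eval_at !ffunE. Qed.

HB.instance Definition _ := GRing.isLinear.Build _ _ _ _ eval_at eval_at_is_linear.

Definition dft_at (b : l2 R N l) : R[i]^o := dft b x.

Lemma dft_at_is_linear : linear dft_at.
Proof.
move=> a f g; rewrite /dft_at !ffunE /GRing.scale /= mulrCA -mulrDr.
congr (_ * _); rewrite mulr_sumr -big_split; apply: eq_bigr => j _.
by rewrite !ffunE /= mulrDl mulrA.
Qed.

HB.instance Definition _ := GRing.isLinear.Build _ _ _ _ dft_at dft_at_is_linear.

End Evaluation.

(** * Residuals of the Zak transform on a grid *)

Section Scale.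
Variables (R : realType) (N l : nat).
Hypothesis N_gt1 : (1 < N)%N.
Variable k : 'I_l.
Local Notation V := (Zdl N l).
Local Notation d := (N ^ 2)%N.
Local Notation chi := (@chi R N l).
Local Notation e := (@unitv N l k).
Implicit Types (b : l2 R N l) (j v x y : V).

Local Notation shift_b := (wcomp (fun=> 1 : R[i]) (fun j : V => j + e)).
Local Notation mod_b := (wcomp (fun j : V => chi j e) id).
Local Notation shift_zak :=
  (wcomp (fun=> 1 : R[i]) (fun p : V * V => (p.1 + e, p.2))).
Local Notation mod_zak :=
  (wcomp (fun p : V * V => chi p.1 e) (fun p : V * V => (p.1, p.2 + e))).

Definition shift_res M m b := iter m (orbit_res shift_zak M) (zak b).
Definition mod_res M m b := iter m (orbit_res mod_zak M) (zak b).

Lemma iter_shift s (p : V * V) :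
  iter s (fun p : V * V => (p.1 + e, p.2)) p = (p.1 + e *+ s, p.2).
Proof.
elim: s => [|s IH]; first by rewrite addr0; case: p.
by rewrite iterS IH /= mulrSr addrA.
Qed.

Lemma iter_modul s (p : V * V) :
  iter s (fun p : V * V => (p.1, p.2 + e)) p = (p.1, p.2 + e *+ s).
Proof.
elim: s => [|s IH]; first by rewrite addr0; case: p.
by rewrite iterS IH /= mulrSr addrA.
Qed.

Lemma iter_shift_zak s f p : iter s shift_zak f p = f (p.1 + e *+ s, p.2).
Proof.
elim: s p => [|s IH] p; first by rewrite addr0; case: p.
by rewrite iterS ffunE mul1r IH /= -addrA -mulrS.
Qed.

Lemma iter_mod_zak s f p :
  iter s mod_zak f p = chi p.1 (e *+ s) * f (p.1, p.2 + e *+ s).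
Proof.
elim: s p => [|s IH] p; first by rewrite addr0 chi0r // mul1r; case: p.
by rewrite iterS ffunE IH /= -addrA -mulrS mulrA mulrS chiDr.
Qed.

Lemma ratio_near1 (a : R) (x y : R[i]) : 0 < a -> a <= normc y ->
  normc (x - y) <= a / 2 -> normc (x / y - 1) <= 1 / 2.
Proof.
move=> a0 ay xy; have y0 : y != 0.
  by rewrite -normc_neq0 gt_eqF // (lt_le_trans a0).
have -> : x / y - 1 = (x - y) / y by field.
rewrite normcM normcV ler_pdivrMr ?(lt_le_trans a0) //.
by lra.
Qed.

(** If the sum were below (a / 8)^2, both residuals would be at most a / 8 at every node, and every
    edge jump at most a / 8 + a / 8 + a / 4 = a / 2. As |zak b| >= a, all transports would satisfy
    |z - 1| <= 1/2, forcing total curvature 0 instead of 2 pi. *)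
Lemma grid_defect (a c : R) b (K L M1 M2 m : nat) (p : V * V) :
  0 < a -> (forall q, a <= normc (zak b q) <= c) ->
  (3 <= K <= N)%N -> (3 <= L <= N)%N -> (0 < M1)%N -> (0 < M2)%N ->
  2 ^+ m.+1 * ((N %/ K).+1%:R / M1%:R) * c <= a / 4 ->
  2 ^+ m.+1 * ((N %/ L).+1%:R / M2%:R) * c <= a / 4 ->
  (a / 8) ^+ 2 <= \sum_(i < K.+1) \sum_(i' < L.+1)
    (normc (shift_res M1 m b (p.1 + e *+ node N K i, p.2 + e *+ node N L i')) ^+ 2 +
     normc (mod_res M2 m b (p.1 + e *+ node N K i, p.2 + e *+ node N L i')) ^+ 2).
Proof.
move=> a0 zb /andP[K3 KN] /andP[L3 LN] M10 M20 hM1 hM2.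
set r1 := shift_res M1 m b; set r2 := mod_res M2 m b.
case: p => j v /=.
pose pt i i' : V * V := (j + e *+ node N K i, v + e *+ node N L i').
have K0 : (0 < K)%N by exact: leq_trans K3.
have L0 : (0 < L)%N by exact: leq_trans L3.
rewrite leNgt; apply/negP => hsum.
have rsmall i i' : (i <= K)%N -> (i' <= L)%N ->
    normc (r1 (pt i i')) <= a / 8 /\ normc (r2 (pt i i')) <= a / 8.
  move=> iK iL.
  have hle : normc (r1 (pt i i')) ^+ 2 + normc (r2 (pt i i')) ^+ 2 <= (a / 8) ^+ 2.
    apply: le_trans (ltW hsum); rewrite (bigD1 (Ordinal (iK : i < K.+1)%N)) //=.
    rewrite (bigD1 (Ordinal (iL : i' < L.+1)%N)) //= -[leLHS]addr0 -addrA.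
    rewrite lerD2l addr_ge0 //; first by rewrite sumr_ge0 // => *; rewrite addr_ge0 ?sqr_ge0.
    by rewrite sumr_ge0 // => *; rewrite sumr_ge0 // => *; rewrite addr_ge0 ?sqr_ge0.
  have a8 : 0 <= a / 8 by rewrite divr_ge0 ?ltW.
  have sqle (y z : R[i]) :
      normc y ^+ 2 + normc z ^+ 2 <= (a / 8) ^+ 2 -> normc y <= a / 8.
    move=> h; rewrite -(@ler_pXn2r R 2) ?nnegrE ?normc_ge0 //.
    by apply: le_trans h; rewrite lerDl sqr_ge0.
  by split; apply: sqle; last (rewrite addrC); exact: hle.
pose g i i' := zak b (pt i i').
have ag i i' : a <= normc (g i i') by have /andP[] := zb (pt i i').
have zak_neq0 q : zak b q != 0.
  by rewrite -normc_neq0 gt_eqF // (lt_le_trans a0) //; case/andP: (zb q).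
have g0 i i' : g i i' != 0 by exact: zak_neq0.
have zbc q : normc (zak b q) <= c by have /andP[] := zb q.
have c0 : 0 <= c by apply: le_trans (zbc (j, v)); exact: normc_ge0.
(* [w] is the phase of the twisted translation along an edge in frequency, [kap] the curvature of a
   cell. *)
pose w i i' : R[i] := chi (j + e *+ node N K i) (e *+ step N L i').
pose kap i i' : R := 2 * pi * ((step N K i)%:R * (step N L i')%:R) / d%:R.
have slow (M n s : nat) : (0 < M)%N -> (s <= (N %/ n).+1)%N ->
    2 ^+ m.+1 * ((N %/ n).+1%:R / M%:R) * c <= a / 4 ->
    2 ^+ m.+1 * (s%:R / M%:R) * c <= a / 4.
  move=> M0 sn; apply: le_trans; rewrite ler_wpM2r // ler_wpM2l ?exprn_ge0 //.
  by rewrite ler_wpM2r ?invr_ge0 // ler_nat.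
have kap_ge0 i i' : 0 <= kap i i'.
  by rewrite !mulr_ge0 ?invr_ge0 ?pi_ge0.
have N0 : N%:R != 0 :> R by rewrite pnatr_eq0 -lt0n ltnW.
(* The steps add up to N in each direction and d = N^2, which gives one full turn. *)
have kap_sum : \sum_(0 <= i < K) \sum_(0 <= i' < L) kap i i' = 2 * pi.
  have sumstep n : (0 < n)%N -> \sum_(0 <= i < n) (step N n i)%:R = N%:R :> R.
    move=> n0; have := telescope_sumr (fun i => (node N n i)%:R : R) (leq0n n).
    rewrite node0 node_last // subr0 => <-.
    by apply: eq_bigr => i _; rewrite natrB ?node_le.
  transitivity (2 * pi / d%:R * ((\sum_(0 <= i < K) (step N K i)%:R) *
      (\sum_(0 <= i' < L) (step N L i')%:R)) : R).
    rewrite mulr_suml mulr_sumr; apply: eq_bigr => i _.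
    by rewrite !mulr_sumr; apply: eq_bigr => i' _; rewrite /kap; ring.
  by rewrite !sumstep // natrX; field.
suff : \sum_(0 <= i < K) \sum_(0 <= i' < L) kap i i' = 0.
  by apply/eqP; rewrite kap_sum mulf_neq0 ?pnatr_eq0 // gt_eqF // pi_gt0.
apply: (@flat_curvature_sum0 R K L g w kap g0).
- by move=> i i'; exact: chi_neq0.
- move=> i i' iK iL; split.
    rewrite /w node_step // mulrnDr addrA.
    rewrite (chiDl _ N_gt1 (j + e *+ node N K i)); congr (_ * _).
    exact: chi_unitv_mul.
  rewrite ger0_norm ?kap_ge0 // /kap.
  (* Here K, L >= 3 enters: 3 s <= 2 N and 3 t <= 2 N give 2 s t <= (8/9) d < d, so each cell has
     curvature below pi. *)
  have h1 : (step N K i * 3 <= 2 * N)%N.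
    by apply: leq_trans (step_mul_le K0 KN i); rewrite leq_mul2l K3 orbT.
  have h2 : (step N L i' * 3 <= 2 * N)%N.
    by apply: leq_trans (step_mul_le L0 LN i'); rewrite leq_mul2l L3 orbT.
  have h : (2 * (step N K i * step N L i') < d)%N.
    by have := leq_mul h1 h2; rewrite -mulnn; nia.
  rewrite ltr_pdivrMr ?ltr0n ?expn_gt0 ?(ltnW N_gt1) // -natrM mulrAC mulrC.
  by rewrite ltr_pM2l ?pi_gt0 // -natrM ltr_nat.
- by move=> i; rewrite /g /pt node_last // node0 addr0 zakDr // unitv_Lam.
(* A full period in position multiplies the Zak transform by chi(-N e, v); its change along the edge
   cancels that of [w]. *)
- move=> i'; rewrite /g /pt /w node_last // node0 addr0 !zakDl ?unitv_Lam //.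
  rewrite node_step // mulrnDr addrA !chiDl // (chiDr _ N_gt1 _ (v + _)) !(chiNl _ N_gt1).
  field.
  by rewrite !chi_neq0 zak_neq0.
- move=> i i' iK iL; apply: ratio_near1 (ag _ _) _ => //.
  have ptS : ((pt i i').1 + e *+ step N K i, (pt i i').2) = pt i.+1 i'.
    by rewrite /pt /= node_step // mulrnDr addrA.
  have -> : g i.+1 i' = iter (step N K i) shift_zak (zak b) (pt i i').
    by rewrite iter_shift_zak ptS.
  have w1 (q : V * V) : normc ((fun=> 1) q : R[i]) = 1 by rewrite normc1.
  apply: le_trans (translate_le_orbit_res _ w1 m _ _ M10 zbc) _.
  rewrite iter_shift ptS -/(shift_res _ _ _) -/r1.
  have [h1 _] := rsmall i.+1 i' iK iL; have [h2 _] := rsmall i i' (ltnW iK) iL.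
  by clear w1; have := slow _ _ _ M10 (step_le K0 KN i) hM1; lra.
- move=> i i' iK iL; apply: ratio_near1 (ag _ _) _ => //.
  have ptS : ((pt i i').1, (pt i i').2 + e *+ step N L i') = pt i i'.+1.
    by rewrite /pt /= node_step // mulrnDr addrA.
  have -> : w i i' * g i i'.+1 = iter (step N L i') mod_zak (zak b) (pt i i').
    by rewrite iter_mod_zak ptS.
  have w1 (q : V * V) : normc (chi q.1 e) = 1 by exact: normc_chi.
  apply: le_trans (translate_le_orbit_res _ w1 m _ _ M20 zbc) _.
  rewrite iter_modul ptS -/(mod_res _ _ _) -/r2.
  have [_ h1] := rsmall i i'.+1 iK iL; have [_ h2] := rsmall i i' iK (ltnW iL).
  have := slow _ _ _ M20 (step_le L0 LN i') hM2; lra.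
Qed.
(** By Parseval the norm can be computed on [b], where the modulation multiplies the value at [j] by
    [chi e j]. For [sum_shift_res] the same is done after passing to [dft b], since the transform
    diagonalises translations. *)
Lemma sum_mod_res M m b :
  \sum_p normc (mod_res M m b p) ^+ 2 = (d ^ l)%:R * (N ^ l)%:R *
    \sum_j normc (1 - M%:R^-1 * \sum_(s < M) chi e j ^+ s) ^+ (2 * m) *
      normc (b j) ^+ 2.
Proof.
have zE f : zak (mod_b f) = mod_zak (zak f) by exact: zak_modulate.
have := orbit_res_intertwine M m b zE; rewrite /mod_res /= => <-.
rewrite zak_parseval //; congr (_ * _); apply: eq_bigr => j _.
have evE f : eval_at j (mod_b f) = chi e j *: eval_at j f.
  by rewrite /eval_at ffunE chiC.
have := orbit_res_intertwine M m b evE.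
rewrite orbit_res_scale /= /eval_at => ->.
by rewrite normcM normcX exprMn -exprM mulnC.
Qed.

Lemma sum_shift_res M m b :
  \sum_p normc (shift_res M m b p) ^+ 2 = (d ^ l)%:R * (N ^ l)%:R *
    \sum_x normc (1 - M%:R^-1 * \sum_(s < M) chi e x ^+ s) ^+ (2 * m) *
      normc (dft b x) ^+ 2.
Proof.
have zE f : zak (shift_b f) = shift_zak (zak f) by exact: zak_translate.
have := orbit_res_intertwine M m b zE; rewrite /shift_res /= => <-.
rewrite zak_parseval // -dft_parseval //; congr (_ * _); apply: eq_bigr => x _.
have evE f : dft_at x (shift_b f) = chi e x *: dft_at x f.
  exact: dft_translate.
have := orbit_res_intertwine M m b evE.
rewrite orbit_res_scale /= /dft_at => ->.
by rewrite normcM normcX exprMn -exprM mulnC.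
Qed.

(** The multiplier is the mean over s < M of 1 - chi(e, x)^s; with t the angle of [chi e x], each
    term is at most 2 and at most s |t| <= M |t|. *)
Lemma normc_multiplier_le M x : (0 < M)%N ->
  normc (1 - M%:R^-1 * \sum_(s < M) chi e x ^+ s) <=
    Num.min 2 (M%:R * (2 * pi * `|(rep (x k))%:~R| / d%:R)).
Proof.
move=> M0; pose t : R := 2 * pi * (rep (x k))%:~R / d%:R.
have M_neq0 : M%:R != 0 :> R[i] by rewrite pnatr_eq0 -lt0n.
have -> : 1 - M%:R^-1 * \sum_(s < M) chi e x ^+ s =
    M%:R^-1 * \sum_(s < M) (1 - chi e x ^+ s).
  by rewrite sumrB sumr_const card_ord mulrBr mulVf.
have tE : 2 * pi * `|(rep (x k))%:~R| / d%:R = `|t|.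
  by rewrite /t !normrM normfV !normr_nat (ger0_norm (pi_ge0 R)).
rewrite tE normcM normcV normc_nat ler_pdivrMl ?ltr0n //.
have bound (a : R) : (forall s : 'I_M, normc (1 - chi e x ^+ s) <= a) ->
    normc (\sum_(s < M) (1 - chi e x ^+ s)) <= M%:R * a.
  move=> ha; apply: le_trans (ler_normc_sum _ _ _) _.
  apply: (@le_trans _ _ (\sum_(s < M) a)); first by apply: ler_sum => s _.
  by rewrite sumr_const card_ord mulr_natl.
apply: bound => s; rewrite le_min chi_unitv // -/t -expiMn; apply/andP; split.
  apply: le_trans (ler_normcB _ _) _.
  by rewrite normc1 normc_expi; lra.
apply: le_trans (normc_1Bexpi _) _; rewrite normrMn -[leLHS]mulr_natl.
by rewrite ler_wpM2r // ler_nat ltnW.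
Qed.

Definition weight M m x : R :=
  Num.min 2 (M%:R * (2 * pi * `|(rep (x k))%:~R| / d%:R)) ^+ (2 * m).

Lemma multiplier_weight M m x : (0 < M)%N ->
  normc (1 - M%:R^-1 * \sum_(s < M) chi e x ^+ s) ^+ (2 * m) <= weight M m x.
Proof.
move=> M0; have h := normc_multiplier_le x M0.
by rewrite /weight lerXn2r ?nnegrE ?normc_ge0 // (le_trans (normc_ge0 _) h).
Qed.

(** [grid_defect] is summed over all base points. The shift to a given node permutes V x V, so each
    of the (K + 1)(L + 1) nodes contributes the full norm of the residuals. *)
Lemma scale_defect (a c : R) b (K L M1 M2 m : nat) :
  0 < a -> (forall q, a <= normc (zak b q) <= c) ->
  (3 <= K <= N)%N -> (3 <= L <= N)%N -> (0 < M1)%N -> (0 < M2)%N ->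
  2 ^+ m.+1 * ((N %/ K).+1%:R / M1%:R) * c <= a / 4 ->
  2 ^+ m.+1 * ((N %/ L).+1%:R / M2%:R) * c <= a / 4 ->
  (a / 8) ^+ 2 * N%:R ^+ l <= K.+1%:R * L.+1%:R *
    (\sum_x weight M1 m x * normc (dft b x) ^+ 2 +
     \sum_j weight M2 m j * normc (b j) ^+ 2).
Proof.
move=> a0 zb hK hL M10 M20 hM1 hM2.
pose F p := normc (shift_res M1 m b p) ^+ 2 + normc (mod_res M2 m b p) ^+ 2.
pose D : R := N%:R ^+ l.
have D0 : 0 < D by rewrite exprn_gt0 // ltr0n ltnW.
have Dd : (d ^ l)%:R = D ^+ 2 :> R by rewrite !natrX -!exprM mulnC.
have hF : (a / 8) ^+ 2 * (D ^+ 2) ^+ 2 <= K.+1%:R * L.+1%:R * \sum_p F p.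
  have -> : (a / 8) ^+ 2 * (D ^+ 2) ^+ 2 = \sum_(p : V * V) (a / 8) ^+ 2.
    rewrite sumr_const card_prod !card_ffun !card_ord prednK ?expn_gt0 ?(ltnW N_gt1) //.
    by rewrite -[RHS]mulr_natr natrM !Dd -expr2.
  apply: (@le_trans _ _ (\sum_(p : V * V) \sum_(i < K.+1) \sum_(i' < L.+1)
      F (p.1 + e *+ node N K i, p.2 + e *+ node N L i'))).
    by apply: ler_sum => p _; exact: grid_defect.
  rewrite exchange_big /=.
  under eq_bigr => i _ do rewrite exchange_big /=.
  have trans i i' : \sum_(p : V * V)
      F (p.1 + e *+ node N K i, p.2 + e *+ node N L i') = \sum_p F p.
    have inj : injective (fun p : V * V =>
        (p.1 + e *+ node N K i, p.2 + e *+ node N L i')).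
      by move=> [x y] [x' y'] /= [/addIr -> /addIr ->].
    by rewrite [RHS](reindex_inj inj).
  under eq_bigr => i _ do under eq_bigr => i' _ do rewrite trans.
  by rewrite !sumr_const !card_ord -mulrnA -[leLHS]mulr_natl natrM [_ * K.+1%:R]mulrC.
have FE : \sum_p F p <= D ^+ 2 * D * (\sum_x weight M1 m x * normc (dft b x) ^+ 2 +
     \sum_j weight M2 m j * normc (b j) ^+ 2).
  have -> := etrans (big_split _ _ _ _ _)
    (congr2 +%R (sum_shift_res M1 m b) (sum_mod_res M2 m b)).
  rewrite Dd natrX -/D -mulrDr.
  have D3 : 0 <= D ^+ 2 * D by rewrite mulr_ge0 ?exprn_ge0 ?(ltW D0).
  rewrite ler_wpM2l // lerD //; apply: ler_sum => x _; rewrite ler_wpM2r ?sqr_ge0 //;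
    exact: multiplier_weight.
have D3 : 0 < D ^+ 2 * D by rewrite -exprSr exprn_gt0.
(* D^4 base points against D^3 from Parseval leave one factor D = N^l. *)
rewrite -(ler_pM2l D3).
have -> : D ^+ 2 * D * ((a / 8) ^+ 2 * D) = (a / 8) ^+ 2 * (D ^+ 2) ^+ 2 by ring.
apply: le_trans hF _; rewrite [leRHS]mulrCA ler_wpM2l ?mulr_ge0 //.
Qed.

End Scale.

(** * Summation over scales *)

Section Dyadic.
Variable R : realType.

(** The terms grow geometrically while 2^i <= Y and decay geometrically afterwards. *)
Lemma dyadic_sum_le (Y : R) (n : nat) : 0 <= Y ->
  \sum_(i < n) 2 ^+ i * Num.min 1 ((Y / 2 ^+ i) ^+ 2) <= 6 * Y.
Proof.
rewrite le_eqVlt => /predU1P[<-|Y0].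
  rewrite mulr0 big1 // => i _; rewrite mul0r expr0n /=.
  by rewrite min_r ?mulr0.
(* The bound is strengthened by the factor 2^n / (2^n + Y) to allow induction on n. *)
apply: (@le_trans _ _ (6 * Y * (2 ^+ n / (2 ^+ n + Y)))); last first.
  have p0 : 0 < 2 ^+ n + Y :> R by rewrite addr_gt0 ?exprn_gt0.
  by rewrite ler_piMr ?mulr_ge0 ?(ltW Y0) // ler_pdivrMr // mul1r lerDl ltW.
elim: n => [|n IH].
  by rewrite big_ord0 !mulr_ge0 ?invr_ge0 ?addr_ge0 // ltW.
rewrite big_ord_recr /= (exprS 2 n); move: IH; set S := \sum_(i < n) _.
have : 0 < 2 ^+ n :> R by rewrite exprn_gt0.
move: (2 ^+ n) => a a0 IH; apply: le_trans (lerD IH (lexx _)) _.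
have h1 : 0 < a + Y by rewrite addr_gt0.
have h2 : 0 < 2 * a + Y by rewrite addr_gt0 // mulr_gt0.
have h12 := ltW (mulr_gt0 h2 h1).
rewrite -lerBrDl.
(* The increment dominates the new term: (2 a + Y)(a + Y) is at most 6 Y^2 if a <= Y and at most 6
   a^2 otherwise, whence the constant 6. *)
have -> : 6 * Y * (2 * a / (2 * a + Y)) - 6 * Y * (a / (a + Y)) =
    6 * a * Y ^+ 2 / ((2 * a + Y) * (a + Y)).
  by field; rewrite !gt_eqF.
rewrite ler_pdivlMr ?mulr_gt0 //.
have [aY|/ltW Ya] := leP a Y.
  apply: (@le_trans _ _ (a * ((2 * a + Y) * (a + Y)))).
    by rewrite ler_wpM2r // ler_piMr ?(ltW a0) // ge_min lexx.
  have -> : 6 * a * Y ^+ 2 = a * (6 * Y ^+ 2) by ring.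
  by rewrite ler_wpM2l ?(ltW a0) //; nra.
apply: (@le_trans _ _ (a * (Y / a) ^+ 2 * ((2 * a + Y) * (a + Y)))).
  by rewrite ler_wpM2r // ler_pM2l // ge_min lexx orbT.
have -> : a * (Y / a) ^+ 2 * ((2 * a + Y) * (a + Y)) =
    Y ^+ 2 / a * ((2 * a + Y) * (a + Y)) by field; rewrite gt_eqF.
have -> : 6 * a * Y ^+ 2 = Y ^+ 2 / a * (6 * a ^+ 2) by field; rewrite gt_eqF.
by rewrite ler_wpM2l ?divr_ge0 ?sqr_ge0 ?(ltW a0) //; nra.
Qed.

(** As T^s = 2^i, with y = z / T this compares min(2, y)^(2m) with min(1, y^(2s)). For y <= 1 use s
    <= m; for y >= 1 the right side is 4^m = 2^(2m). *)
Lemma min_exp_le (m i : nat) (s z : R) : 0 < s -> s <= m%:R -> 0 <= z ->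
  Num.min 2 (z / 2 `^ (i%:R / s)) ^+ (2 * m) <=
    4 ^+ m * Num.min 1 ((z `^ s / 2 ^+ i) ^+ 2).
Proof.
move=> s0 sm z0; set T := 2 `^ (i%:R / s).
have T0 : 0 < T by exact: powR_gt0.
have Tn0 : T != 0 by rewrite gt_eqF.
have T1 : T `^ s = 2 ^+ i by rewrite /T -powRrM divfK ?gt_eqF // powR_mulrn.
have -> : z `^ s / 2 ^+ i = (z / T) `^ s.
  rewrite -{1}(divfK Tn0 z) (powRM s (divr_ge0 z0 (ltW T0)) (ltW T0)) T1 mulfK //.
  by rewrite expf_neq0 ?pnatr_eq0.
have : 0 <= z / T by rewrite divr_ge0 // ltW.
move: (z / T) => y y0.
have four : 4 ^+ m = 2 ^+ (2 * m) :> R by rewrite exprM; congr (_ ^+ _); ring.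
have min0 : 0 <= Num.min 2 y by rewrite le_min y0 ler0n.
have e1 : 1 `^ s = 1 :> R by rewrite powR1.
have [y1|/ltW y1] := leP y 1.
  have ys : y `^ s <= 1.
    by rewrite -[leRHS]e1; apply: (ge0_ler_powR (ltW s0)); rewrite ?nnegrE.
  rewrite (min_r (_ : _ <= 1)); last by rewrite expr_le1 ?powR_ge0.
  apply: (@le_trans _ _ (y ^+ (2 * m))).
    by rewrite lerXn2r ?nnegrE // ge_min lexx orbT.
  apply: (@le_trans _ _ ((y `^ s) ^+ 2)).
    rewrite mulnC exprM lerXn2r ?nnegrE ?exprn_ge0 ?powR_ge0 //.
    have [->|yn0] := eqVneq y 0.
      by rewrite expr0n; case: (m) sm => [|m' _]; rewrite ?powR_ge0 // leNgt s0.
    by rewrite -powR_mulrn // ger_powR // y1 lt_neqAle eq_sym yn0 y0.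
  by rewrite ler_peMl ?sqr_ge0 // exprn_ege1 // ler1n.
have ys : 1 <= y `^ s.
  by rewrite -[leLHS]e1; apply: (ge0_ler_powR (ltW s0)); rewrite ?nnegrE.
rewrite (min_l (_ : 1 <= _)) ?mulr1; last by rewrite exprn_ege1.
by rewrite four lerXn2r ?nnegrE // ge_min lexx.
Qed.

(** With t = trunc_log 2 N >= 7, ln N <= 2 (t + 1) <= 3 (t - 1). The predecessor counts the scales i
    with 4 2^i <= N. *)
Lemma ln_nat_le (N : nat) : (200 <= N)%N ->
  ln N%:R <= 3 * (trunc_log 2 N).-1%:R :> R.
Proof.
move=> hN; have N0 : (0 < N)%N by lia.
have h1 := trunc_log_ltn N (isT : (1 < 2)%N).
have h2 : (7 <= trunc_log 2 N)%N by apply: trunc_log_max => //; lia.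
have ln2 : ln 2 < 2 :> R by exact: ln_sublinear.
apply: (@le_trans _ _ (ln (2 ^+ (trunc_log 2 N).+1))).
  by rewrite ler_ln ?posrE ?exprn_gt0 ?ltr0n // -natrX ler_nat ltnW.
rewrite lnXn // -[leLHS]mulr_natl.
case: (trunc_log 2 N) h2 => // t h2 /=.
have t6 : 6 <= t%:R :> R by rewrite ler_nat.
apply: (@le_trans _ _ (t.+2%:R * 2)); first by rewrite ler_wpM2l // ltW.
by rewrite -addn2 natrD; lra.
Qed.

End Dyadic.

(** * From residuals to moments *)

Section Summation.
Variables (R : realType) (N l : nat).
Hypothesis N_gt1 : (1 < N)%N.
Variable k : 'I_l.

Lemma grid_size (s : R) (i : nat) : 1 < s -> (4 * 2 ^ i <= N)%N ->
  exists K : nat, [/\ (3 <= K <= N)%N, 2 `^ (i%:R / s) <= K%:R :> R &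
    K.+1%:R <= 5 * 2 `^ (i%:R / s) :> R].
Proof.
move=> s1 iN; set T := 2 `^ (i%:R / s).
have T1 : 1 <= T.
  by rewrite -[leLHS](powRr0 2) ler_powR ?ler1n // divr_ge0 // ltW // (lt_trans _ s1).
have Ti : T <= 2 ^+ i.
  rewrite -powR_mulrn // ler_powR ?ler1n // ler_pdivrMr ?(lt_trans _ s1) //.
  by rewrite ler_peMr // ltW.
have T3 : 0 <= 3 * T by lra.
have /andP[h1 h2] := truncn_itv T3.
(* Since T >= 1, this K satisfies 4 <= K <= 4 T <= 4 2^i <= N and K + 1 <= 5 T. *)
exists (Num.truncn (3 * T)).+1; split.
- apply/andP; split; first by rewrite ltnS ltnW // truncn_ge_nat //; lra.
  apply: leq_trans iN; rewrite -(ler_nat R) natrM natrX -addn1 natrD; lra.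
- by rewrite (le_trans _ (ltW h2)) //; lra.
- by rewrite -addn2 natrD; lra.
Qed.

(** A bound for [weight] in which the grid enters only through T <= K. The constant collects 2^(m +
    3) from the number of translates, 2 from floor(N / K) + 1 <= 2 N / K, and 8 >= 2 pi. *)
Definition scaled_weight (m kap : nat) (T : R) (x : Zdl N l) : R :=
  Num.min 2 ((2 ^+ (m + 7) * kap%:R) * `|(rep (x k))%:~R / N%:R| / T) ^+ (2 * m).

Lemma weight_scaled (m kap K : nat) (T : R) (x : Zdl N l) :
  (0 < K <= N)%N -> 0 < T -> T <= K%:R ->
  weight R k (2 ^ (m + 3) * kap * (N %/ K).+1) m x <= scaled_weight m kap T x.
Proof.
move=> /andP[K0 KN] T0 TK; rewrite /weight /scaled_weight.
have K0' : 0 < K%:R :> R by rewrite ltr0n.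
have N0 : 0 < N%:R :> R by rewrite ltr0n ltnW.
set r := `|(rep (x k))%:~R|; have r0 : 0 <= r := normr_ge0 _.
have -> : `|(rep (x k))%:~R / N%:R| = r / N%:R by rewrite normrM normfV (gtr0_norm N0).
set a := (_ * kap * _)%N%:R * _; set c := _ / T.
have a0 : 0 <= a by rewrite !mulr_ge0 ?invr_ge0 ?pi_ge0.
have ac : a <= c.
  have hq : (N %/ K).+1%:R <= 2 * N%:R / K%:R :> R.
    rewrite ler_pdivlMr // -!natrM ler_nat mulSn.
    by have := leq_divM N K; lia.
  have hpi : 2 * pi <= 8 :> R by have := pihalf_lt2 R; lra.
  apply: (@le_trans _ _ (2 ^+ (m + 3) * kap%:R * (2 * N%:R / K%:R) * (8 * r / N%:R ^+ 2))).
    rewrite /a (natrX _ N) !natrM !natrX; apply: ler_pM.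
    - by rewrite !mulr_ge0 ?exprn_ge0.
    - by rewrite !mulr_ge0 ?invr_ge0 ?exprn_ge0 ?pi_ge0.
    - by rewrite ler_wpM2l // mulr_ge0 ?exprn_ge0.
    - by rewrite ler_wpM2r ?invr_ge0 ?exprn_ge0 ?(ltW N0) // ler_wpM2r.
  have -> : 2 ^+ (m + 3) * kap%:R * (2 * N%:R / K%:R) * (8 * r / N%:R ^+ 2) =
      2 ^+ (m + 7) * kap%:R * (r / N%:R) / K%:R :> R.
    have -> : (m + 7 = m + 3 + 4)%N by rewrite -addnA.
    by rewrite !exprD; field; rewrite !gt_eqF.
  rewrite /c ler_wpM2l ?lef_pV2 ?posrE //.
  by rewrite !mulr_ge0 ?exprn_ge0 ?invr_ge0 // ltW.
have c0 : 0 <= c by exact: le_trans ac.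
by rewrite lerXn2r ?nnegrE ?le_min ?a0 ?c0 ?ler0n // !ge_min lexx ac orbT.
Qed.

Lemma scaled_defect (A B p q : R) (b : l2 R N l) (m kap i : nat) :
  0 < A -> 1 < p -> 1 < q -> p^-1 + q^-1 = 1 ->
  gabor_riesz_basis A B b -> Num.sqrt (B / A) <= kap%:R -> (0 < kap)%N ->
  (4 * 2 ^ i <= N)%N ->
  A / 64 * N%:R ^+ l <= 25 * 2 ^+ i *
    (\sum_x scaled_weight m kap (2 `^ (i%:R / q)) x * normc (dft b x) ^+ 2 +
     \sum_j scaled_weight m kap (2 `^ (i%:R / p)) j * normc (b j) ^+ 2).
Proof.
move=> A0 p1 q1 pq hb hkap kap0 iN.
have [K [/andP[K3 KN] TK KT]] := grid_size q1 iN.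
have [L [/andP[L3 LN] TL LT]] := grid_size p1 iN.
have K0 : (0 < K)%N by exact: leq_trans K3.
have L0 : (0 < L)%N by exact: leq_trans L3.
have sqA : 0 < Num.sqrt A by rewrite sqrtr_gt0.
have zb pt : Num.sqrt A <= normc (zak b pt) <= Num.sqrt B.
  have /andP[h1 h2] := zak_bounds N_gt1 pt hb.
  rewrite -[normc _]ger0_norm ?normc_ge0 // -sqrtr_sqr !ler_sqrt ?h1 //.
    by rewrite (le_trans (sqr_ge0 _) h2).
  exact: sqr_ge0.
have B0 : 0 <= B.
  have /andP[h1 h2] := zak_bounds N_gt1 (0, 0) hb.
  by rewrite (le_trans (sqr_ge0 _) h2).
have hsq : Num.sqrt B <= kap%:R * Num.sqrt A.
  rewrite -ler_pdivrMr // (le_trans _ hkap) //.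
  by rewrite sqrtrM // sqrtrV // ltW.
(* 2^(m + 1) / 2^(m + 3) = 1/4, and [kap] absorbs sqrt(B / A); this dictates the number of
   translates [M]. *)
have small n : 2 ^+ m.+1 * (n.+1%:R / (2 ^ (m + 3) * kap * n.+1)%N%:R) *
    Num.sqrt B <= Num.sqrt A / 4.
  have k0 : kap%:R != 0 :> R by rewrite pnatr_eq0 -lt0n.
  have -> : 2 ^+ m.+1 * (n.+1%:R / (2 ^ (m + 3) * kap * n.+1)%N%:R) * Num.sqrt B =
      Num.sqrt B / kap%:R / 4.
    have -> : (m + 3 = m.+1 + 2)%N by rewrite addSnnS.
    rewrite !natrM natrX exprD; field.
    by rewrite k0 nat1r pnatr_eq0 expf_neq0 // pnatr_eq0.
  by rewrite ler_wpM2r ?invr_ge0 // ler_pdivrMr ?ltr0n // mulrC.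
pose M n := (2 ^ (m + 3) * kap * (N %/ n).+1)%N.
have M0 n : (0 < M n)%N by rewrite !muln_gt0 expn_gt0 kap0.
have := scale_defect N_gt1 k sqA zb (introT andP (conj K3 KN))
  (introT andP (conj L3 LN)) (M0 K) (M0 L) (small _) (small _).
have -> : (Num.sqrt A / 8) ^+ 2 = A / 64.
  by rewrite exprMn sqr_sqrtr ?ltW // exprVn -natrX.
move=> /le_trans; apply.
(* Conjugacy of p and q makes (K + 1)(L + 1) at most 25 2^i. *)
have TT : 2 `^ (i%:R / q) * 2 `^ (i%:R / p) = 2 ^+ i :> R.
  rewrite -powRD; last by rewrite pnatr_eq0 implybT.
  by rewrite -mulrDr [q^-1 + _]addrC pq mulr1 powR_mulrn.
have T0 s : 0 < 2 `^ (i%:R / s) :> R by exact: powR_gt0.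
have w0 M' x : 0 <= weight R k M' m x.
  rewrite /weight exprn_ge0 // le_min ler0n /=.
  by rewrite !mulr_ge0 ?invr_ge0 ?pi_ge0 ?exprn_ge0.
apply: ler_pM.
- by rewrite mulr_ge0.
- by rewrite addr_ge0 ?sumr_ge0 // => x _; rewrite mulr_ge0 ?w0 ?sqr_ge0.
- rewrite -TT; have := ler_pM (ler0n _ _) (ler0n _ _) KT LT; lra.
- by apply: lerD; apply: ler_sum => x _; rewrite ler_wpM2r ?sqr_ge0 //;
    apply: weight_scaled; rewrite ?T0 // ?KN ?LN ?K0 ?L0.
Qed.

(** After exchanging the sums, [min_exp_le] and [dyadic_sum_le] apply at each point with Y = (c
    y)^s, where c = 2^(m + 7) kap and y = |x_k / N|. *)
Lemma sum_scaled_weight (s : R) (m kap J : nat) (F : Zdl N l -> R) :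
  1 < s -> s <= m%:R -> (forall x, 0 <= F x) ->
  \sum_(i < J) 2 ^+ i * (\sum_x scaled_weight m kap (2 `^ (i%:R / s)) x * F x)
    <= 6 * 4 ^+ m * (2 ^+ (m + 7) * kap%:R) `^ s *
       \sum_(x : Zdl N l) `|(rep (x k))%:~R / N%:R| `^ s * F x.
Proof.
move=> s1 sm F0; have s0 : 0 < s by exact: lt_trans s1.
under eq_bigr => i _ do rewrite mulr_sumr.
rewrite exchange_big /= mulr_sumr; apply: ler_sum => x _.
under eq_bigr => i _ do rewrite mulrA.
rewrite -mulr_suml mulrA ler_wpM2r //.
set c := 2 ^+ (m + 7) * kap%:R; set y := `|_|.
have c0 : 0 <= c by rewrite mulr_ge0 ?exprn_ge0.
have y0 : 0 <= y by exact: normr_ge0.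
rewrite -mulrA -powRM //.
apply: (@le_trans _ _ (\sum_(i < J) 4 ^+ m * (2 ^+ i *
    Num.min 1 (((c * y) `^ s / 2 ^+ i) ^+ 2)))).
  apply: ler_sum => i _; rewrite mulrCA ler_wpM2l ?exprn_ge0 //.
  by apply: min_exp_le => //; rewrite mulr_ge0.
have -> : 6 * 4 ^+ m * (c * y) `^ s = 4 ^+ m * (6 * (c * y) `^ s) by ring.
rewrite -mulr_sumr ler_wpM2l ?exprn_ge0 //.
by rewrite dyadic_sum_le ?powR_ge0.
Qed.

End Summation.

Unset Implicit Arguments.

(** * Summing the scales *)

Theorem theorem1p8 (R : realType) (A B p q : R)
    (hA : 0 < A) (hB : 0 < B) (hp : 1 < p) (hq : 1 < q)
    (hpq : p^-1 + q^-1 = 1) :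
  exists C : R, 0 < C /\
    forall N : nat, 200 * Num.sqrt (B / A) <= N%:R ->
    forall l : nat, (1 <= l)%N ->
    forall b : l2 R N l, gabor_riesz_basis A B b ->
    forall k : 'I_l,
      C * ln N%:R
        <= (N%:R ^+ l)^-1 *
             (\sum_(j : Zdl N l)
                `|(rep (j k))%:~R / N%:R| `^ p * normc (b j) ^+ 2)
         + (N%:R ^+ l)^-1 *
             (\sum_(j : Zdl N l)
                `|(rep (j k))%:~R / N%:R| `^ q * normc (dft b j) ^+ 2).
Proof.
(* [kap] and [m] depend on A, B, p and q only, and so will the constant. *)
pose kap := (Num.truncn (Num.sqrt (B / A))).+1.
pose m := (Num.truncn (p + q)).+1.
have hkap : Num.sqrt (B / A) <= kap%:R by rewrite ltW // truncnS_gt.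
have hm : p + q <= m%:R by rewrite ltW // truncnS_gt.
pose c : R := 2 ^+ (m + 7) * kap%:R.
have c0 : 0 < c by rewrite mulr_gt0 ?exprn_gt0 ?ltr0n.
(* 150 = 25 x 6, from [scaled_defect] and [sum_scaled_weight]. *)
pose E : R := 150 * 4 ^+ m * (c `^ p + c `^ q).
have E0 : 0 < E by rewrite !mulr_gt0 ?exprn_gt0 // addr_gt0 // powR_gt0.
(* 192 = 3 x 64, from ln N <= 3 J and the factor A / 64 at each scale. *)
exists (A / (192 * E)); split; first by rewrite divr_gt0 // mulr_gt0.
move=> N hN l l1 b hb k.
set Sp := \sum_j _; set Sq := \sum_j _.
have Sp0 : 0 <= Sp by apply: sumr_ge0 => j _; rewrite mulr_ge0 ?powR_ge0 ?sqr_ge0.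
have Sq0 : 0 <= Sq by apply: sumr_ge0 => j _; rewrite mulr_ge0 ?powR_ge0 ?sqr_ge0.
(* For N <= 1 the left side vanishes, [ln 0] being 0 by convention. *)
have [N1|N_gt1] := leqP N 1.
  have -> : ln N%:R = 0 :> R.
    by case: N N1 {hN b hb Sp Sq Sp0 Sq0} => [|[|//]] _; rewrite ?ln1 // ln0.
  by rewrite mulr0 addr_ge0 // mulr_ge0 ?invr_ge0 ?exprn_ge0.
(* The Zak bounds force A <= B, so the hypothesis on N gives N >= 200. *)
have N200 : (200 <= N)%N.
  have /andP[h1 h2] := zak_bounds N_gt1 (0, 0) hb.
  have AB : 1 <= Num.sqrt (B / A).
    by rewrite -[leLHS]sqrtr1 ler_wsqrtr // ler_pdivlMr // mul1r (le_trans h1).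
  by rewrite -(ler_nat R); lra.
pose J := (trunc_log 2 N).-1.
have JN (i : 'I_J) : (4 * 2 ^ i <= N)%N.
  rewrite -[4%N]/(2 ^ 2)%N -expnD.
  apply: leq_trans (trunc_logP (isT : (1 < 2)%N) (ltnW N_gt1)).
  by rewrite leq_exp2l // add2n -ltn_predRL ltn_ord.
have lnN : ln N%:R <= 3 * J%:R :> R by exact: ln_nat_le.
have D0 : 0 < N%:R ^+ l :> R by rewrite exprn_gt0 // ltr0n ltnW.
(* Every one of the J scales contributes the same lower bound; this is where log N arises. *)
have key : J%:R * (A / 64 * N%:R ^+ l) <= E * (Sp + Sq).
  have -> : J%:R * (A / 64 * N%:R ^+ l) = \sum_(i < J) A / 64 * N%:R ^+ l.
    by rewrite sumr_const card_ord mulr_natl.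
  have hi (i : 'I_J) := @scaled_defect R N l N_gt1 k A B p q b m kap i hA hp hq hpq
    hb hkap isT (JN i).
  apply: le_trans (ler_sum _ (fun i _ => hi i)) _.
  under eq_bigr => i _ do rewrite -mulrA mulrDr.
  rewrite -mulr_sumr big_split /=.
  have pm : p <= m%:R by lra.
  have qm : q <= m%:R by lra.
  have := @sum_scaled_weight R N l k q m kap J _ hq qm (fun x => sqr_ge0 (normc (dft b x))).
  have := @sum_scaled_weight R N l k p m kap J _ hp pm (fun x => sqr_ge0 (normc (b x))).
  rewrite -/c -/Sp -/Sq; set Wp := \sum_(i < J) _; set Wq := \sum_(i < J) _ => hWp hWq.
  apply: (@le_trans _ _ (25 * (6 * 4 ^+ m * c `^ q * Sq + 6 * 4 ^+ m * c `^ p * Sp))).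
    by rewrite ler_wpM2l // lerD.
  (* These cross terms complete the bound to a multiple of (c^p + c^q)(Sp + Sq). *)
  have h : 0 <= 4 ^+ m * (c `^ p * Sq + c `^ q * Sp).
    by rewrite mulr_ge0 ?exprn_ge0 // addr_ge0 // mulr_ge0 ?powR_ge0.
  by rewrite /E; lra.
have E192 : 0 < 192 * E by rewrite mulr_gt0.
rewrite -mulrDr -(ler_pM2l E192) -(ler_pM2l D0).
have -> : N%:R ^+ l * (192 * E * (A / (192 * E) * ln N%:R)) =
    A * N%:R ^+ l * ln N%:R by field; rewrite gt_eqF.
have -> : N%:R ^+ l * (192 * E * ((N%:R ^+ l)^-1 * (Sp + Sq))) =
    192 * (E * (Sp + Sq)) by field; rewrite gt_eqF.
apply: (@le_trans _ _ (A * N%:R ^+ l * (3 * J%:R))); last by lra.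
by rewrite ler_wpM2l // mulr_ge0 ?ltW.
Qed.
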